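(* Suppose that $\kappa \geq \omega_2$ is a regular cardinal and ${\sf cNSP}_\kappa$ holds. Then Shelah's Strong Hypothesis ($\sf SSH$) holds above $\kappa$, i.e., $\mathrm{pp}(\mu) = \mu^+$ for every singular cardinal $\mu > \kappa$.
   Context: For a regular uncountable cardinal $\kappa$ and a cardinal $\lambda \geq \kappa$, $\mathscr{P}_\kappa \lambda = \{x \subseteq \lambda \mid |x| < \kappa\}$. A concrete $\mathscr{P}_\kappa \lambda$-system is a structure $\mathcal S = \langle S_x \mid x \in A \rangle$ such that (1) $A$ is a $\subseteq$-cofinal subset of $\mathscr{P}_\kappa \lambda$; (2) for all $x \in A$, $\emptyset \neq S_x \subseteq \mathscr{P}(x)$; (3) for all $x \subseteq y$ both in $A$, there is $t \in S_y$ with $t \cap x \in S_x$. Its width is $\sup\{|S_x| \mid x \in A\}$, and it is narrow if $\mathrm{width}(\mathcal S)^+ < \kappa$. A cofinal branch through $\mathcal S$ is a set $b \subseteq \lambda$ such that $\{x \in A \mid b \cap x \in S_x\}$ is $\subseteq$-cofinal in $\mathscr{P}_\kappa \lambda$. ${\sf cNSP}(\mathscr{P}_\kappa\lambda)$ is the assertion that every narrow concrete $\mathscr{P}_\kappa \lambda$-system has a cofinal branch, and ${\sf cNSP}_\kappa$ is the assertion that ${\sf cNSP}(\mathscr{P}_\kappa\lambda)$ holds for all cardinals $\lambda \geq \kappa$. $\mathrm{pp}(\mu)$ denotes Shelah's pseudopower of the singular cardinal $\mu$. *)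

(* Defs.v *)
From mathcomp Require Import all_boot.
From mathcomp Require Import boolp classical_sets functions cardinality.
From mathcomp Require wochoice.

Set Implicit Arguments.
Unset Strict Implicit.
Unset Printing Implicit Defensive.

Local Open Scope classical_set_scope.
Local Open Scope card_scope.

Reserved Notation "A '#<' B" (at level 79, format "A  '#<'  B").

Definition card_lt T U (A : set T) (B : set U) : Prop := A #<= B /\ A #!= B.
Notation "A '#<' B" := (card_lt A B) : card_scope.

(* Ordinals are well-ordered types and cardinals are initial ordinals.  All of
   them live in one fixed universe, that of the field ord_car; quantification
   over Ord or Card plays the role of quantification over all ordinals
   or cardinals.  Being an ordinal is thus understood up to isomorphism, so the
   cardinal-valued operations (successor, supremum, cofinality, width, pp) are
   given as relations rather than functions. *)
Record Ord := MkOrd {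
  ord_car :> Type;
  ole : rel ord_car;
  ole_wo : wochoice.well_order ole }.

Definition olt (W : Ord) (x y : W) : Prop := ~~ ole y x.

Definition below (W : Ord) (x : W) : set W := [set y | olt y x].

Definition initial (W : Ord) : Prop :=
  forall x : W, below x #< [set: W].

Record Card := MkCard {
  card_ord :> Ord;
  card_initial : initial card_ord }.

Lemma seg_wo (W : Ord) (x : W) :
  wochoice.well_order (fun y z : below x => ole (val y) (val z)).
Proof.
move=> A [y0 Ay0].
pose B : {pred W} := fun w => `[< exists2 y : below x, y \in A & val y = w >].
have BP w : w \in B <-> exists2 y : below x, y \in A & val y = w.
  by split=> [/asboolP|h] //; apply/asboolP.
have [|w [[/BP[y Ay yw] minw] uniqw]] := @ole_wo W B.
  by exists (val y0); apply/BP; exists y0.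
exists y; split=> [|z [Az minz]].
  by split=> // z Az; rewrite yw; apply: minw; apply/BP; exists z.
apply/val_inj; rewrite yw; apply: uniqw; split; first by apply/BP; exists z.
by move=> _ /BP[t At <-]; apply: minz.
Qed.

(* An element x of the ordinal W, regarded as an ordinal itself. *)
Definition seg (W : Ord) (x : W) : Ord := MkOrd (seg_wo (x := x)).

Lemma leq_wo : wochoice.well_order leq.
Proof.
move=> A Ane; have [n An minn] := ex_minnP Ane.
exists n; split=> [|m [Am minm]]; first by split=> // m; apply: minn.
by apply/anti_leq; rewrite minn// minm.
Qed.

Definition omega_ord : Ord := MkOrd leq_wo.

Lemma omega_initial : initial omega_ord.
Proof.
move=> n; have -> : @below omega_ord n = `I_n :> set nat.
  by apply/funext => m; rewrite /below /olt /mkset /= -ltnNge.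
split; first exact: card_leT.
apply/negP => nT; apply: infinite_nat; rewrite (eq_finite_set (card_esym nT)).
exact: finite_II.
Qed.

Definition omega : Card := MkCard omega_initial.

Definition is_succ (c d : Card) : Prop :=
  [set: c] #< [set: d] /\
  forall e : Card, [set: c] #< [set: e] -> [set: d] #<= [set: e].

Definition is_sup (C : Card -> Prop) (s : Card) : Prop :=
  (forall c, C c -> [set: c] #<= [set: s]) /\
  forall t : Card, (forall c, C c -> [set: c] #<= [set: t]) ->
    [set: s] #<= [set: t].

Definition cofinal (W : Ord) (a : set W) : Prop :=
  forall x : W, exists2 y, a y & ole x y.

Definition is_cf (W c : Ord) : Prop :=
  [/\ initial c,
      exists2 a : set W, cofinal a & a #= [set: c] &
      forall a : set W, cofinal a -> [set: c] #<= a].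

Definition regular (W : Ord) : Prop :=
  infinite_set [set: W] /\ is_cf W W.

Definition singular (m : Card) : Prop :=
  infinite_set [set: m] /\ exists2 c : Card, is_cf m c & [set: c] #< [set: m].

Definition Pk (kappa lambda : Card) : set (set lambda) :=
  [set x | x #< [set: kappa]].
Arguments Pk : clear implicits.

Definition cofinal_Pk (kappa lambda : Card) (A : set (set lambda)) : Prop :=
  A `<=` Pk kappa lambda /\
  forall x, Pk kappa lambda x -> exists2 y, A y & x `<=` y.

(* The system <S_x | x in A>; the values of S outside A are irrelevant. *)
Definition concrete_system (kappa lambda : Card)
    (A : set (set lambda)) (S : set lambda -> set (set lambda)) : Prop :=
  [/\ cofinal_Pk kappa A,
      forall x, A x -> S x !=set0 /\ (forall t, S x t -> t `<=` x) &
      forall x y, A x -> A y -> x `<=` y -> exists2 t, S y t & S x (t `&` x)].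

Definition is_width (lambda : Card)
    (A : set (set lambda)) (S : set lambda -> set (set lambda)) (w : Card) :=
  is_sup (fun c => exists2 x, A x & [set: c] #= S x) w.

Definition narrow (kappa lambda : Card)
    (A : set (set lambda)) (S : set lambda -> set (set lambda)) : Prop :=
  exists w w' : Card,
    [/\ is_width A S w, is_succ w w' & [set: w'] #< [set: kappa]].

Definition cofinal_branch (kappa lambda : Card)
    (A : set (set lambda)) (S : set lambda -> set (set lambda))
    (b : set lambda) : Prop :=
  cofinal_Pk kappa [set x | A x /\ S x (b `&` x)].

Definition cNSP_at (kappa lambda : Card) : Prop :=
  forall (A : set (set lambda)) (S : set lambda -> set (set lambda)),
    concrete_system kappa A S -> narrow kappa A S ->
    exists b : set lambda, cofinal_branch kappa A S b.

Definition cNSP (kappa : Card) : Prop :=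
  forall lambda : Card, [set: kappa] #<= [set: lambda] ->
    cNSP_at kappa lambda.

Definition ideal_on T (a : set T) (I : set (set T)) : Prop :=
  [/\ I set0, ~ I a,
      forall b, I b -> b `<=` a,
      forall b c, I c -> b `<=` c -> I b &
      forall b c, I b -> I c -> I (b `|` c)].

(* The ideal of bounded subsets of a. *)
Definition Jbd (m : Ord) (a : set m) : set (set m) :=
  [set b | b `<=` a /\ exists beta : m, forall alpha, b alpha -> olt alpha beta].

(* The product of the ordinals in a: functions f with f(alpha) < alpha for all
   alpha in a; the values of f outside a are irrelevant. *)
Definition ord_prod (m : Ord) (a : set m) : set (m -> m) :=
  [set f | forall alpha, a alpha -> olt (f alpha) alpha].

Definition lt_mod (m : Ord) (a : set m) (I : set (set m)) (f g : m -> m) :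
    Prop :=
  I [set alpha | a alpha /\ ~ olt (f alpha) (g alpha)].

(* theta is the true cofinality of (prod a, <_I): theta is regular and there is
   a <_I-increasing sequence of length theta which is cofinal in prod a. *)
Definition is_tcf (m : Ord) (a : set m) (I : set (set m))
    (theta : Card) : Prop :=
  regular theta /\
  exists F : theta -> (m -> m),
    [/\ forall i, ord_prod a (F i),
        forall i j, olt i j -> lt_mod a I (F i) (F j) &
        forall g, ord_prod a g -> exists i, lt_mod a I g (F i)].

(* The cardinals tcf(prod a / I), where a is a cofinal set of regular cardinals
   below mu with |a| <= cf(mu), and I is a (proper) ideal on a which extends
   the ideal of bounded subsets of a and for which the true cofinality
   exists. *)
Definition pp_set (mu theta : Card) : Prop :=
  exists (a : set mu) (I : set (set mu)),
    [/\ cofinal a /\ (forall alpha, a alpha -> regular (seg alpha)),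
        exists2 c : Card, is_cf mu c & a #<= [set: c],
        ideal_on a I,
        Jbd a `<=` I &
        is_tcf a I theta].

Definition is_pp (mu nu : Card) : Prop := is_sup (pp_set mu) nu.

(* Main.v *)
Require Import Defs.
From mathcomp Require Import all_boot.
From mathcomp Require Import boolp classical_sets functions cardinality filter.
From mathcomp Require wochoice.

(** Write lambda^+ for the successor of lambda.  The core is a covering theorem:
    for kappa <= delta <= lambda, the subsets of lambda of size at most delta are
    covered by lambda^+ many sets of size at most delta.  It is proved by
    induction on lambda.

    If cf(lambda) = omega, take a matrix of sets D(n, b), n < omega,
    b < lambda^+, of size less than lambda, increasing in b modulo finitely many
    n.  Club guessing makes it approachable, so that for each x of size < kappa
    the traces D(n, b) /\ x stabilize, modulo finitely many n, as b grows.  The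
    stable traces form a system of countable width, and a cofinal branch yields
    a set of size lambda^+ whose countable subsets are covered by the D(n, b);
    hence countable subsets of lambda are covered by lambda^+ many sets of size
    less than lambda, and the induction hypothesis does the rest.  If
    omega < cf(lambda) <= delta, a pressing-down argument in the style of Silver's
    theorem makes any two subsets of size delta comparable, and a matrix as above
    prevents a single set of size delta from covering lambda^+ many sets that
    have been chosen one outside the union of the others.

    Given a scale of length theta > mu^+ in a product below mu, the covering
    theorem puts theta many of its functions inside one set of size less than
    mu, so they are bounded: pp(mu) <= mu^+.  Conversely, products of successor
    cardinals modulo an ultrafilter are mu^+-directed, so pp(mu) >= mu^+. *)

Set Implicit Arguments.
Unset Strict Implicit.
Unset Printing Implicit Defensive.

Local Open Scope classical_set_scope.
Local Open Scope card_scope.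

(** * Well-ordered types *)

Section WellOrder.
Variable W : Ord.
Implicit Types x y z : W.

Lemma wo_least (P : W -> Prop) :
  (exists x, P x) -> exists x, P x /\ forall y, P y -> ole x y.
Proof.
move=> [x0 Px0]; pose A : {pred W} := fun x => `[< P x >].
have [|x [[/asboolP Px minx] _]] := @ole_wo W A; first by exists x0; apply/asboolP.
by exists x; split=> // y Py; apply: minx; apply/asboolP.
Qed.

(** A well-order is given only through unique minima of nonempty sets; totality, antisymmetry and
    transitivity come from minima of sets of two or three points. *)
Lemma ole_total x y : ole x y \/ ole y x.
Proof.
have [|z [[->|->] minz]] := @wo_least (fun t => t = x \/ t = y).
- by exists x; left.
- by left; apply: minz; right.
- by right; apply: minz; left.
Qed.

Lemma ole_refl x : ole x x.
Proof. by case: (ole_total x x). Qed.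

Lemma ole_anti x y : ole x y -> ole y x -> x = y.
Proof.
move=> xy yx; pose A : {pred W} := fun t => `[< t = x \/ t = y >].
have [|z [_ uniqz]] := @ole_wo W A; first by exists x; apply/asboolP; left.
have minE t : t = x \/ t = y -> wochoice.minimum_of (@ole W) A t.
  move=> txy; split; first exact/asboolP.
  by move=> s /asboolP sxy; case: txy => ->; case: sxy => ->; rewrite ?ole_refl.
by rewrite -(uniqz x (minE x (or_introl erefl))); apply: uniqz (minE y (or_intror erefl)).
Qed.

Lemma ole_trans y x z : ole x y -> ole y z -> ole x z.
Proof.
move=> xy yz; have [|t [txyz mint]] := @wo_least (fun t => [\/ t = x, t = y | t = z]).
  by exists x; constructor 1.
case: txyz => tE; rewrite tE in mint.
- by apply: mint; constructor 3.
- have <- : y = x by apply: ole_anti => //; apply: mint; constructor 1.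
  by [].
- have zy : z = y by apply: ole_anti => //; apply: mint; constructor 2.
  by rewrite zy.
Qed.

Lemma olt_irr x : ~ olt x x.
Proof. by rewrite /olt ole_refl. Qed.

Lemma oltNle x y : ~ olt x y <-> ole y x.
Proof. by rewrite /olt; split=> [/negP|->//]; rewrite negbK. Qed.

Lemma oleNlt x y : ~ ole x y <-> olt y x.
Proof. by rewrite /olt; split=> [/negP|/negP]. Qed.

Lemma olt_ole x y : olt x y -> ole x y.
Proof. by move=> xy; case: (ole_total x y) => // yx; rewrite /olt yx in xy. Qed.

Lemma ole_lt_trans y x z : ole x y -> olt y z -> olt x z.
Proof.
by move=> xy /oleNlt yz; apply/oleNlt => zx; apply: yz; apply: ole_trans zx xy.
Qed.

Lemma olt_le_trans y x z : olt x y -> ole y z -> olt x z.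
Proof.
by move=> /oleNlt xy yz; apply/oleNlt => zx; apply: xy; apply: ole_trans yz zx.
Qed.

Lemma olt_trans y x z : olt x y -> olt y z -> olt x z.
Proof. by move=> /olt_ole; apply: ole_lt_trans. Qed.

Lemma olt_neq x y : ole x y -> x <> y -> olt x y.
Proof. by move=> xy nxy; apply/oleNlt => yx; apply: nxy; apply: ole_anti. Qed.

Lemma olt_leP x y : olt x y \/ ole y x.
Proof. by case: (pselect (ole y x)) => [|/oleNlt]; [right|left]. Qed.

Lemma olt_ind (P : W -> Prop) :
  (forall x, (forall y, olt y x -> P y) -> P x) -> forall x, P x.
Proof.
move=> IH x; apply: contrapT => nPx.
have [|y [nPy miny]] := @wo_least (fun x => ~ P x); first by exists x.
by apply: nPy; apply: IH => z zy; apply: contrapT => /miny /oltNle.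
Qed.

(** Recursion with choice: [R i f t] says that [t] is a legal value at [i] after the values of [f]
    below [i]. A legal value need exist only if all earlier values are legal; [h] picks one when it
    can, and the approximations [isrec] are glued along the diagonal. *)
Lemma wo_rec (T : Type) (t0 : T) (R : W -> (W -> T) -> T -> Prop) :
  (forall i f g t, (forall j, olt j i -> f j = g j) -> R i f t -> R i g t) ->
  (forall i f, (forall j, olt j i -> R j f (f j)) -> exists t, R i f t) ->
  exists f, forall i, R i f (f i).
Proof.
move=> Rloc Rex.
have [h hP] : exists h : W -> (W -> T) -> T,
    forall i f, (exists t, R i f t) -> R i f (h i f).
  have /choice[h hP] : forall p : W * (W -> T), exists t,
      (exists t, R p.1 p.2 t) -> R p.1 p.2 t.
    move=> p; have [[t Rt]|nR] := pselect (exists t, R p.1 p.2 t).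
      by exists t.
    by exists t0.
  by exists (fun i f => h (i, f)) => i f; apply: hP (i, f).
(* Values outside the segment are overwritten by [t0], so [h i] sees only the restriction of [f] to
   it. *)
pose cut i (f : W -> T) j := if `[< olt j i >] then f j else t0.
pose isrec i f := forall j, ole j i -> f j = h j (cut j f).
have cut_eq i f g : (forall j, olt j i -> f j = g j) -> cut i f = cut i g.
  move=> fg; apply/funext => j; rewrite /cut.
  by case: asboolP => // /fg.
have uniq_rec i k f g : isrec i f -> isrec k g ->
    forall j, ole j i -> ole j k -> f j = g j.
  move=> rf rg; apply: olt_ind => j IH ji jk; rewrite rf// rg//; congr (h j _).
  by apply: cut_eq => l lj; apply: IH => //; apply: ole_trans (olt_ole lj) _.
have /choice[F FP] : forall i, exists f, isrec i f.
  apply: olt_ind => i IH.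
  have /choice[G GP] : forall j, exists f, olt j i -> isrec j f.
    move=> j; have [ji|nji] := pselect (olt j i).
      by have [f fP] := IH j ji; exists f.
    by exists (fun=> t0).
  pose f0 j := G j j.
  have f0P j : olt j i -> f0 j = h j (cut j f0).
    move=> ji; rewrite /f0 (GP j ji j (ole_refl j)); congr (h j _).
    apply: cut_eq => k kj; have ki := olt_trans kj ji.
    by apply: (uniq_rec j k); [apply: GP| apply: GP|apply: olt_ole|apply: ole_refl].
  exists (fun j => if `[< olt j i >] then f0 j else h i (cut i f0)) => j ji.
  have cutE : cut j (fun k => if `[< olt k i >] then f0 k else h i (cut i f0)) = cut j f0.
    by apply: cut_eq => k kj; rewrite asboolT//; apply: olt_le_trans kj ji.
  rewrite cutE; case: asboolP => [/f0P//|/oltNle ij].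
  by rewrite (ole_anti ij ji).
exists (fun i => F i i); apply: olt_ind => i IH.
have fE : F i i = h i (cut i (fun i => F i i)).
  rewrite (FP i i (ole_refl i)); congr (h i _); apply: cut_eq => j ji.
  by apply: (uniq_rec i j) => //; [apply: olt_ole|apply: ole_refl].
have cutl f : forall j, olt j i -> cut i f j = f j.
  by move=> j ji; rewrite /cut asboolT.
rewrite fE.
apply: (Rloc i (cut i (fun i => F i i))); first exact: cutl.
apply: hP; have [t Rt] := Rex i _ IH; exists t.
by apply: Rloc Rt => j ji; rewrite cutl.
Qed.

End WellOrder.

(** * Cardinal comparison *)

Section Comparison.
Implicit Types T U V : Type.

Lemma card_le_inj T U (A : set T) (B : set U) (f : T -> U) :
  (forall x, A x -> B (f x)) ->
  (forall x y, A x -> A y -> f x = f y -> x = y) -> A #<= B.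
Proof.
move=> fAB finj.
have /injfunPex[g] : exists2 f : T -> U, set_fun A B f & set_inj A f.
  exists f; first exact: fAB.
  by move=> x y /set_mem Ax /set_mem Ay; apply: finj.
exact: inj_card_le.
Qed.

Lemma card_le_rel T U (A : set T) (B : set U) (R : T -> U -> Prop) :
  (forall x, A x -> exists2 y, B y & R x y) ->
  (forall x x' y, A x -> A x' -> R x y -> R x' y -> x = x') -> A #<= B.
Proof.
move=> RAB Rinj.
have [[x0 Ax0]|A0] := pselect (exists x, A x); last first.
  have -> : A = set0 by apply/seteqP; split=> x // Ax; apply: A0; exists x.
  exact: card_ge0.
have [y0 _ _] := RAB x0 Ax0.
have /choice[f fP] : forall x, exists y, A x -> B y /\ R x y.
  move=> x; have [Ax|nAx] := pselect (A x); last by exists y0.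
  by have [y By Rxy] := RAB x Ax; exists y.
apply: (@card_le_inj _ _ A B f) => [x /fP[]//|x y Ax Ay e].
have [_ Rx] := fP x Ax; have [_ Ry] := fP y Ay.
by apply: (Rinj x y (f x)) => //; rewrite e.
Qed.

Lemma card_le_surj T U (A : set T) (B : set U) (g : U -> T) :
  (forall x, A x -> exists2 y, B y & g y = x) -> A #<= B.
Proof.
move=> gAB; apply: (@card_le_rel _ _ A B (fun x y => g y = x)) => //.
by move=> x x' y _ _ <- <-.
Qed.

Lemma card_leEinj T U (u0 : U) (A : set T) (B : set U) : A #<= B ->
  exists f : T -> U, (forall x, A x -> B (f x)) /\
    (forall x y, A x -> A y -> f x = f y -> x = y).
Proof.
move=> /card_leP[f].
pose g x := if pselect (A x) is left h then val (f (SigSub (mem_set h))) else u0.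
exists g; split=> [x Ax|x y Ax Ay]; rewrite /g.
  by case: pselect => // h; apply: set_mem; apply: (valP (f _)).
case: pselect => // hx; case: pselect => // hy /val_inj e.
have /(_ (in_setT _) (in_setT _) e) := @inj _ _ _ f (SigSub (mem_set hx)) (SigSub (mem_set hy)).
by move=> /(congr1 val).
Qed.

Lemma card_leEsurj T U (t0 : T) (A : set T) (B : set U) : A #<= B ->
  exists g : U -> T, forall x, A x -> exists2 y, B y & g y = x.
Proof.
move=> AB.
have [[u0]|nU] := pselect (inhabited U); last first.
  exists (fun=> t0) => x Ax; have /card_leP[f] := AB.
  by exfalso; apply: nU; split; exact: val (f (SigSub (mem_set Ax))).
have [f [fB finj]] := card_leEinj u0 AB.
have /choice[g gP] : forall y, exists x, (exists2 x, A x & f x = y) -> A x /\ f x = y.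
  move=> y; have [[x Ax fx]|nx] := pselect (exists2 x, A x & f x = y).
    by exists x.
  by exists t0.
exists g => x Ax; exists (f x); first exact: fB.
by have [|Ag fg] := gP (f x); [exists x|apply: finj].
Qed.

Lemma card_le_setT_sub T (A : set T) : [set: A] #<= A.
Proof. by have /card_eqPle[] := card_setT A. Qed.

Lemma card_le_sub_setT T (A : set T) : A #<= [set: A].
Proof. by have /card_eqPle[] := card_setT A. Qed.

Lemma type_wo T : exists R : rel T, wochoice.well_order R.
Proof. by have [R] := wochoice.well_ordering_principle {classic T}; exists R. Qed.

(* Sending each x to a point of B not used before x never gets stuck. *)
Lemma wo_card_le (W : Ord) U (B : set U) :
  (forall x : W, ~ (B #<= below x)) -> [set: W] #<= B.
Proof.
move=> nB.
have [[x0]|nW] := pselect (inhabited W); last first.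
  have -> : [set: W] = set0 by apply/seteqP; split=> x // _; apply: nW.
  exact: card_ge0.
have [[u0]|nU] := pselect (inhabited U); last first.
  exfalso; apply: (nB x0); have -> : B = set0.
    by apply/seteqP; split=> x // _; apply: nU.
  exact: card_ge0.
have [||f fP] := @wo_rec W U u0 (fun i f t => B t /\ forall j, olt j i -> f j <> t).
- move=> i f g t fg [Bt ft]; split=> // j ji; rewrite -fg//; exact: ft.
- move=> i f _; apply: contrapT => nt; apply: (nB i).
  apply: (@card_le_surj _ _ _ _ f) => t Bt; apply: contrapT => nf; apply: nt.
  by exists t; split=> // j ji fj; apply: nf; exists j.
apply: (@card_le_inj _ _ _ _ f) => [x _|x y _ _ fxy]; first by case: (fP x).
have [_ fx] := fP x; have [_ fy] := fP y.
have [xy|yx] := olt_leP x y; first by have := fy x xy.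
by apply: contrapT => nxy; apply: (fx y) => //; apply: olt_neq => // e; apply: nxy.
Qed.

Lemma card_le_total T U (A : set T) (B : set U) : A #<= B \/ B #<= A.
Proof.
have [R Rwo] := type_wo A; pose W := MkOrd Rwo.
have [[x Bx]|nB] := pselect (exists x : W, B #<= below x); [right|left].
  exact: card_le_trans Bx (card_le_trans (card_leT _) (card_le_setT_sub A)).
apply: card_le_trans (card_le_sub_setT A) _.
by apply: (@wo_card_le W) => x Bx; apply: nB; exists x.
Qed.

Lemma card_ltNge T U (A : set T) (B : set U) : A #< B <-> ~ (B #<= A).
Proof.
split=> [[AB nAB] BA|nBA]; first by case/negP: nAB; apply: Cantor_Bernstein.
have [AB|//] := card_le_total A B; split=> //; apply/negP => /card_eqPle[_].
exact: nBA.
Qed.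

Lemma card_leNgt T U (A : set T) (B : set U) : A #<= B <-> ~ (B #< A).
Proof.
split=> [AB /card_ltNge//|nBA]; apply: contrapT => nAB; apply: nBA.
exact/card_ltNge.
Qed.

Lemma card_ltW T U (A : set T) (B : set U) : A #< B -> A #<= B.
Proof. by case. Qed.

Lemma card_lt_irr T (A : set T) : ~ (A #< A).
Proof. by move=> /card_ltNge; apply. Qed.

Lemma card_lt_le_trans T U V (B : set U) (A : set T) (C : set V) :
  A #< B -> B #<= C -> A #< C.
Proof.
move=> /card_ltNge AB BC; apply/card_ltNge => CA; apply: AB.
exact: card_le_trans BC CA.
Qed.

Lemma card_le_lt_trans T U V (B : set U) (A : set T) (C : set V) :
  A #<= B -> B #< C -> A #< C.
Proof.
move=> AB /card_ltNge BC; apply/card_ltNge => CA; apply: BC.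
exact: card_le_trans CA AB.
Qed.

Lemma card_lt_leP T U (A : set T) (B : set U) : A #< B \/ B #<= A.
Proof. by have [BA|/card_ltNge AB] := pselect (B #<= A); [right|left]. Qed.

Lemma card_lt_powerset T (A : set T) : A #< [set B : set T | B `<=` A].
Proof.
apply/card_ltNge => le.
have [[t0]|nT] := pselect (inhabited T); last first.
  have [g gP] := card_leEsurj (set0 : set T) le.
  by have [//|x _ _] := gP set0; apply: nT.
have [f [fA finj]] := card_leEinj t0 le.
pose D := [set x | exists2 B : set T, B `<=` A & f B = x /\ ~ B x].
have DA : D `<=` A by move=> _ [B BA [<- _]]; apply: fA.
have [DfD|nDfD] := pselect (D (f D)).
  have [B BA [fB nB]] := DfD; apply: nB.
  by have -> : B = D by apply: finj.
by apply: (nDfD); exists D.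
Qed.

End Comparison.

(** * Cardinals *)

Section Cardinals.
Implicit Types c d e : Card.

(** If [W] is not initial, the least proper segment into which it embeds is. *)
Lemma ord_card_below (W : Ord) : exists (c : Card), [set: c] #= [set: W].
Proof.
have [Wi|nWi] := pselect (initial W); first by exists (MkCard Wi).
have [|x [Wx minx]] := @wo_least W (fun x => [set: W] #<= below x).
  apply: contrapT => nx; apply: nWi => x; apply/card_ltNge => Wx.
  by apply: nx; exists x.
have segi : initial (seg x).
  move=> y; apply/card_ltNge => le; have vy : olt (val y) x := set_mem (valP y).
  suff /minx /oltNle : [set: W] #<= below (val y) by [].
  apply: card_le_trans Wx _; apply: card_le_trans (card_le_sub_setT _) _.
  apply: card_le_trans le _.
  by apply: (@card_le_inj _ _ _ _ val) => [//|? ? _ _ /val_inj].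
exists (MkCard segi); apply/card_eqPle; split.
  exact: card_le_trans (card_le_setT_sub _) (card_leT _).
exact: card_le_trans Wx (card_le_sub_setT _).
Qed.

Lemma card_of T (A : set T) : exists c : Card, [set: c] #= A.
Proof.
have [R Rwo] := type_wo A; have [c cA] := ord_card_below (MkOrd Rwo).
by exists c; apply: card_eq_trans cA (card_setT A).
Qed.

Lemma card_lt_below (W : Ord) T (A : set T) : A #< [set: W] ->
  exists z : W, below z #= A.
Proof.
move=> /card_ltNge AW.
have [|z [Az minz]] := @wo_least W (fun z => A #<= below z).
  apply: contrapT => nz; apply: AW; apply: wo_card_le => x Ax.
  by apply: nz; exists x.
exists z; apply: Cantor_Bernstein => //.
apply: card_le_trans (card_le_sub_setT _) _.
apply: (@wo_card_le (seg z)) => y Ay.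
have vy : olt (val y) z := set_mem (valP y).
suff /minz /oltNle : A #<= below (val y) by [].
apply: card_le_trans Ay _.
by apply: (@card_le_inj _ _ _ _ val) => [//|? ? _ _ /val_inj].
Qed.

(** [Card] is not itself a well-order, so the minimum is sought among the segments of one [c0]
    satisfying [P]; if none of them has the size of a cardinal in [P], then [c0] is least. *)
Lemma least_card (P : Card -> Prop) : (exists c, P c) ->
  exists c, P c /\ forall e, P e -> [set: c] #<= [set: e].
Proof.
move=> [c0 Pc0].
have [[z [d [Pd dz]]]|nz] :=
    pselect (exists z : c0, exists e, P e /\ [set: e] #= below z); last first.
  exists c0; split=> // e Pe; apply/card_leNgt => /card_lt_below[z ze].
  by apply: nz; exists z, e; split=> //; apply: card_esym.
have [|y [[e [Pe ey]] miny]] :=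
    @wo_least c0 (fun x => exists e, P e /\ [set: e] #= below x).
  by exists z, d.
exists e; split=> // f Pf; apply/card_leNgt => fe.
have /card_eqPle[ey1 ey2] := ey.
have [z' z'f] : exists z : c0, below z #= [set: f].
  apply: card_lt_below; apply: card_lt_le_trans fe _.
  exact: card_le_trans ey1 (card_leT _).
have /miny yz' : exists e, P e /\ [set: e] #= below z'.
  by exists f; split=> //; apply: card_esym.
have /card_eqPle[zf1 zf2] := z'f.
apply: (@card_lt_irr _ [set: f]); apply: card_lt_le_trans fe _.
apply: card_le_trans ey1 (card_le_trans _ zf1).
by apply: subset_card_le => t ty; apply: olt_le_trans ty yz'.
Qed.

Lemma succ_exists c : exists d, is_succ c d.
Proof.
have [e /card_eqPle[e1 e2]] := card_of [set: set c].
have [|d [cd mind]] := @least_card (fun d => [set: c] #< [set: d]); last by exists d.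
exists e; apply: card_lt_le_trans e2.
apply: card_lt_le_trans (card_lt_powerset [set: c]) _.
exact: card_leT.
Qed.

Lemma lt_succ_le c d T (A : set T) : is_succ c d -> A #< [set: d] -> A #<= [set: c].
Proof.
move=> [cd mind] Ad; apply/card_leNgt => cA.
have [e /card_eqPle[eA Ae]] := card_of A.
apply: (@card_lt_irr _ A); apply: card_lt_le_trans Ad _.
apply: card_le_trans eA; apply: mind; exact: card_lt_le_trans cA Ae.
Qed.

Lemma below_succ_le c d (x : d) : is_succ c d -> below x #<= [set: c].
Proof. by move=> cd; apply: lt_succ_le cd _; apply: card_initial. Qed.

End Cardinals.

(** * Arithmetic of infinite cardinals *)

Section InfiniteArithmetic.
Implicit Types T U V : Type.

Lemma infinite_card_le T U (A : set T) (B : set U) :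
  A #<= B -> infinite_set A -> infinite_set B.
Proof. by move=> AB Ai Bf; apply: Ai; apply: card_le_finite AB Bf. Qed.

Lemma finite_lt_infinite T U (A : set T) (B : set U) :
  finite_set A -> infinite_set B -> A #< B.
Proof. by move=> Af Bi; apply/card_ltNge => /infinite_card_le /(_ Bi). Qed.

(** Hilbert's hotel: [x] goes to [f 0], each other [f n] moves to [f n.+1], everything else
    stays. *)
Lemma infinite_add1 T (A : set T) (x : T) : infinite_set A -> x |` A #<= A.
Proof.
move=> /infiniteP /(card_leEinj x)[f [fA finj]].
have finj' m n : f m = f n -> m = n by apply: finj.
apply: (@card_le_rel _ _ _ _ (fun s t => (s = x /\ t = f 0) \/
   (s <> x /\ ((exists2 n, s = f n & t = f n.+1) \/
              ((forall n, s <> f n) /\ t = s))))).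
- move=> s sA; have [->|sx] := pselect (s = x).
    by exists (f 0); [apply: fA|left].
  have As : A s by case: sA.
  have [[n sn]|nf] := pselect (exists n, s = f n).
    by exists (f n.+1); [apply: fA|right; split=> //; left; exists n].
  by exists s => //; right; split=> //; right; split=> // n sn; apply: nf; exists n.
- move=> s s' t _ _ [[-> ->]|[sx [[n -> ->]|[nf ->]]]]
      [[-> h]|[s'x [[n' -> h]|[nf' h]]]] //.
  + by have := finj' _ _ h.
  + by case: (nf' 0).
  + by have := finj' _ _ h.
  + by have [->] := finj' _ _ h.
  + by case: (nf' n.+1).
  + by case: (nf 0).
  + by case: (nf n'.+1).
Qed.

Lemma card_no_max (c : Card) : infinite_set [set: c] ->
  forall x : c, exists y, olt x y.
Proof.
move=> ci x; apply: contrapT => nx.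
have cE : [set: c] `<=` x |` below x.
  move=> y _; have [->|yx] := pselect (y = x); first by left.
  by right; apply: olt_neq => //; apply/oltNle => xy; apply: nx; exists y.
have lt := card_initial x; have [fx|ix] := pselect (finite_set (below x)).
  by apply: ci; apply: sub_finite_set cE _; rewrite finite_setU; split.
apply: (@card_lt_irr _ [set: c]); apply: card_le_lt_trans lt.
exact: card_le_trans (subset_card_le cE) (infinite_add1 _ ix).
Qed.

Lemma below_le_lt (c : Card) (x : c) : infinite_set [set: c] ->
  [set y | ole y x] #< [set: c].
Proof.
move=> /card_no_max /(_ x)[y xy]; apply: card_le_lt_trans (card_initial y).
by apply: subset_card_le => z zx; apply: ole_lt_trans zx xy.
Qed.

(** Points are compared by rank first and by a fixed well-order second. Each proper initial segment
    then lies in some [[set x | ole (r x) m]], so [B] never embeds in one and [wo_card_le]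
    applies. *)
Lemma rank_card_le (c : Ord) T U (r : T -> c) (B : set U) :
  (forall m, [set x | ole (r x) m] #< B) -> [set: T] #<= B.
Proof.
move=> rB; have [R Rwo] := type_wo T; pose W := MkOrd Rwo.
pose le (x y : T) := `[< olt (r x) (r y) \/ (r x = r y /\ R x y) >].
have lewo : wochoice.well_order le.
  move=> A [x0 Ax0].
  have [|m [[y [Ay <-]] minm]] := @wo_least c (fun m => exists x, x \in A /\ r x = m).
    by exists (r x0), x0.
  have [|z [[Az rz] minz]] := @wo_least W (fun x => x \in A /\ r x = r y).
    by exists y.
  exists z; split=> [|t [At mint]].
    split=> // t At; apply/asboolP; have [rzt|rtz] := olt_leP (r z) (r t); first by left.
    have e : r t = r y.
      by apply: ole_anti; [rewrite -rz | apply: minm; exists t].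
    by right; split; [rewrite rz e|apply: minz].
  have /asboolP[rtz|[rtz Rtz]] := mint z Az.
    exfalso; move: rtz; rewrite rz => /oleNlt; apply; apply: minm; by exists t.
  apply: (@ole_anti W) => //; apply: minz; split=> //; by rewrite rtz.
apply: (@wo_card_le (MkOrd lewo)) => x Bx.
apply: (@card_lt_irr _ B); apply: card_le_lt_trans Bx _.
apply: card_le_lt_trans (rB (r x)); apply: subset_card_le => y /negP yx.
apply/oltNle => rxy; apply: yx; apply/asboolP; by left.
Qed.

Lemma card_le_setX T T' U U' (A : set T) (B : set U) (A' : set T') (B' : set U') :
  A #<= A' -> B #<= B' -> A `*` B #<= A' `*` B'.
Proof.
move=> AA BB.
have [[[a b] [/= Aa Bb]]|n] := pselect (exists p, (A `*` B) p); last first.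
  have -> : A `*` B = set0 by apply/seteqP; split=> p // ABp; apply: n; exists p.
  exact: card_ge0.
have [a'] : exists a', A' a'.
  apply: contrapT => nA; have e : A' = set0.
    by apply/seteqP; split=> x // Ax; apply: nA; exists x.
  by move: AA; rewrite e => /card_le0P A0; rewrite A0 in Aa.
have [b'] : exists b', B' b'.
  apply: contrapT => nA; have e : B' = set0.
    by apply/seteqP; split=> x // Ax; apply: nA; exists x.
  by move: BB; rewrite e => /card_le0P A0; rewrite A0 in Bb.
move=> _ _; have [f [fA finj]] := card_leEinj a' AA.
have [g [gB ginj]] := card_leEinj b' BB.
apply: (@card_le_inj _ _ _ _ (fun p => (f p.1, g p.2))).
  by move=> [x y] [/= Ax By]; split; [apply: fA|apply: gB].
move=> [x y] [x2 y2] [/= Ax By] [/= Ax2 By2] [fe ge].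
by rewrite (finj x x2)// (ginj y y2).
Qed.

(** Hessenberg's theorem: in a least counterexample [d], pairs are ranked by their maximum, and
    those of rank at most [m] lie in a square that is smaller than [d] by minimality. *)
Lemma infinite_card_sqr (c : Card) : infinite_set [set: c] ->
  [set: c * c] #<= [set: c].
Proof.
move=> ci; apply: contrapT => nc.
have [|d [[di nd] mind]] := @least_card
    (fun d => infinite_set [set: d] /\ ~ ([set: d * d] #<= [set: d])).
  by exists c.
apply: nd; pose mx (p : d * d) := if ole p.1 p.2 then p.2 else p.1.
apply: (@rank_card_le d _ _ mx) => m.
have sub : [set p | ole (mx p) m] `<=` [set y | ole y m] `*` [set y | ole y m].
  move=> [x y]; rewrite /mkset /mx /=; case: ifP => [xy ym|/negP/oleNlt yx xm].
    by split=> //=; apply: ole_trans ym.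
  by split=> //=; apply: ole_trans xm; apply: olt_ole.
apply: card_le_lt_trans (subset_card_le sub) _.
have lt := below_le_lt m di.
have [f|i] := pselect (finite_set [set y | ole y m]).
  by apply: finite_lt_infinite => //; apply: finite_setX.
have [e /card_eqPle[e1 e2]] := card_of [set y | ole y m].
apply: card_le_lt_trans (card_le_setX e2 e2) _; rewrite setXTT.
apply: card_le_lt_trans (lt); apply: card_le_trans (e1).
apply: contrapT => ne; apply: (@card_lt_irr _ [set: d]).
apply: card_le_lt_trans (card_le_lt_trans e1 lt); apply: mind; split=> //.
exact: infinite_card_le e2 i.
Qed.

Lemma infinite_setX_le T U V (A : set T) (B : set U) (N : set V) :
  infinite_set N -> A #<= N -> B #<= N -> A `*` B #<= N.
Proof.
move=> Ni AN BN; have [e /card_eqPle[e1 e2]] := card_of N.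
apply: card_le_trans (card_le_setX AN BN) _.
apply: card_le_trans (card_le_setX e2 e2) _; rewrite setXTT.
apply: card_le_trans e1; apply: infinite_card_sqr.
exact: infinite_card_le e2 Ni.
Qed.

Lemma bigcup_card_le I T V (D : set I) (F : I -> set T) (N : set V) :
  infinite_set N -> D #<= N -> (forall i, D i -> F i #<= N) ->
  \bigcup_(i in D) F i #<= N.
Proof.
move=> Ni DN FN; have [v0 _] := infinite_setN0 Ni.
have [f [fN finj]] := card_leEinj v0 DN.
have /choice[g gP] : forall i, exists g : T -> V, D i ->
    (forall x, F i x -> N (g x)) /\ (forall x y, F i x -> F i y -> g x = g y -> x = y).
  move=> i; have [Di|nDi] := pselect (D i); last by exists (fun=> v0).
  by have [g gP] := card_leEinj v0 (FN i Di); exists g.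
apply: card_le_trans (infinite_setX_le Ni (card_lexx N) (card_lexx N)).
apply: (@card_le_rel _ _ _ _ (fun x p => exists i, [/\ D i, F i x & p = (f i, g i x)])).
  move=> x [i Di Fx]; exists (f i, g i x); last by exists i.
  by split; [apply: fN|apply: (gP i Di).1].
move=> x x' p _ _ [i [Di Fx ->]] [j [Dj Fx']] [/finj ij]; rewrite -ij// in Fx' *.
exact: (gP i Di).2.
Qed.

Lemma infinite_setU_le T V (A B : set T) (N : set V) :
  infinite_set N -> A #<= N -> B #<= N -> A `|` B #<= N.
Proof.
move=> Ni AN BN; rewrite -bigcup2E; apply: bigcup_card_le => //.
  by apply/infiniteP.
by move=> [|[|n]] _ //=; apply: card_ge0.
Qed.

(** * Regular cardinals *)

Lemma regular_bounded (d : Card) (a : set d) :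
  regular d -> a #< [set: d] -> exists x, forall y, a y -> olt y x.
Proof.
move=> [_ [_ _ cfd]] /card_ltNge ad; apply: contrapT => nx; apply: ad; apply: cfd.
move=> x; apply: contrapT => ny; apply: nx; exists x => y ay.
by apply/oleNlt => xy; apply: ny; exists y.
Qed.

Lemma regular_unbounded_card (d : Card) (a : set d) :
  regular d -> (forall x, exists2 y, a y & ole x y) -> [set: d] #<= a.
Proof. by move=> [_ [_ _ cfd]] /cfd. Qed.

Lemma succ_infinite (c d : Card) :
  infinite_set [set: c] -> is_succ c d -> infinite_set [set: d].
Proof. by move=> ci [[cd _] _]; apply: infinite_card_le cd ci. Qed.

Lemma succ_regular (c d : Card) :
  infinite_set [set: c] -> is_succ c d -> regular d.
Proof.
move=> ci cd; have di := succ_infinite ci cd.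
split=> //; split; first exact: card_initial.
  by exists [set: d] => // x; exists x => //; apply: ole_refl.
move=> a acof; apply/card_leNgt => ad; have [cltd _] := cd.
suff : [set: d] #<= [set: c] by move/card_ltNge : cltd.
apply: card_le_trans (_ : _ #<= \bigcup_(x in a) [set y | ole y x]) _.
  by apply: subset_card_le => x _; have [y ay xy] := acof x; exists y.
apply: bigcup_card_le => //; first exact: lt_succ_le cd ad.
by move=> x _; apply: lt_succ_le cd _; apply: below_le_lt.
Qed.

Lemma regular_bigcup_lt (d : Card) I T (D : set I) (F : I -> set T) :
  regular d -> D #< [set: d] -> (forall i, D i -> F i #< [set: d]) ->
  \bigcup_(i in D) F i #< [set: d].
Proof.
move=> dreg Dd Fd; have [di _] := dreg; have [x0 _] := infinite_setN0 di.
have /choice[x xP] : forall i, exists x : d, D i -> F i #<= below x.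
  move=> i; have [Di|nDi] := pselect (D i); last by exists x0.
  by have [z /card_eqPle[_ zF]] := card_lt_below (Fd i Di); exists z.
have [z /card_eqPle[_ Dz]] := card_lt_below Dd.
have [|m mP] := @regular_bounded d (x @` D) dreg.
  exact: card_le_lt_trans (card_image_le _ _) Dd.
have [k [mk zk]] : exists k : d, ole m k /\ ole z k.
  by have [mz|zm] := ole_total m z; [exists z|exists m]; split=> //; apply: ole_refl.
have sub (y k' : d) : ole y k' -> below y `<=` below k'.
  by move=> yk t ty; apply: olt_le_trans ty yk.
have FK i : D i -> F i #<= below k.
  move=> Di; apply: card_le_trans (xP i Di) (subset_card_le (sub _ _ _)).
  by apply: ole_trans mk; apply: olt_ole; apply: mP; exists i.
have DK := card_le_trans Dz (subset_card_le (sub _ _ zk)).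
(* For a countable [d] the segment below [k] is finite and [bigcup_card_le] does not apply. *)
have [kf|ki] := pselect (finite_set (below k)).
  apply: finite_lt_infinite => //; apply: bigcup_finite.
    exact: card_le_finite DK kf.
  by move=> i /FK FKi; apply: card_le_finite FKi kf.
apply: card_le_lt_trans (card_initial k).
exact: bigcup_card_le.
Qed.

(** * Cofinalities *)

Lemma cf_exists (W : Ord) : exists c : Card, is_cf W c.
Proof.
have [|c [[a acof ac] minc]] := @least_card
    (fun c => exists2 a : set W, cofinal a & a #= [set: c]).
  have [c cW] := card_of [set: W]; exists c, [set: W]; last exact: card_esym.
  by move=> x; exists x => //; apply: ole_refl.
exists c; split; [exact: card_initial|by exists a|].
move=> b bcof; have [e /card_eqPle[e1 e2]] := card_of b.
apply: card_le_trans (minc e _) (e1); exists b => //.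
by apply/card_eqPle.
Qed.

Lemma cf_cofinal_map (W : Ord) (c : Card) (w0 : W) : is_cf W c ->
  exists chi : c -> W, (forall i j, ole i j -> ole (chi i) (chi j)) /\
    (forall x, exists i, ole x (chi i)).
Proof.
move=> [_ [a acof ac] minc]; have /card_eqPle[ac1 ac2] := ac.
have [r rP] := card_leEsurj w0 ac1.
(* [chi i] is the least upper bound of [r] on the indices up to [i]; if there were none, the values
   below [i] would be cofinal, against the minimality of [c]. *)
have /choice[chi chiP] : forall i : c, exists x : W,
    (forall j, ole j i -> ole (r j) x) /\
    (forall y, (forall j, ole j i -> ole (r j) y) -> ole x y).
  move=> i; apply: wo_least; apply: contrapT => nx.
  have cof : cofinal (r @` below i).
    move=> x; apply: contrapT => ny.
    have lt j : olt j i -> olt (r j) x.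
      by move=> ji; apply/oleNlt => xj; apply: ny; exists (r j) => //; exists j.
    have [xi|ix] := ole_total x (r i).
      apply: nx; exists (r i) => j ji; have [->|nji] := pselect (j = i).
        exact: ole_refl.
      by apply: ole_trans xi; apply: olt_ole; apply: lt; apply: olt_neq.
    apply: nx; exists x => j ji; have [->//|nji] := pselect (j = i).
    by apply: olt_ole; apply: lt; apply: olt_neq.
  apply: (@card_lt_irr _ [set: c]).
  apply: card_le_lt_trans (card_initial i).
  exact: card_le_trans (minc _ cof) (card_image_le _ _).
exists chi; split=> [i j ij|x].
  by apply: (chiP i).2 => k ki; apply: (chiP j).1; apply: ole_trans ki ij.
have [y ay xy] := acof x; have [i _ ri] := rP y ay; exists i.
by apply: ole_trans xy _; rewrite -ri; apply: (chiP i).1; apply: ole_refl.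
Qed.

Lemma cf_infinite (W c : Card) :
  infinite_set [set: W] -> is_cf W c -> infinite_set [set: c].
Proof.
move=> Wi Wc cf; have [w0 _] := infinite_setN0 Wi.
have [chi [_ chicof]] := cf_cofinal_map w0 Wc.
have [x0 _] := chicof w0.
have /choice[nx nxP] := card_no_max Wi.
have fin : finite_set (range chi) by apply: finite_image.
suff [m mP] : exists m : W, forall y, range chi y -> ole y m.
  have [i mi] := chicof (nx m); apply: (@olt_irr W m).
  apply: olt_le_trans (nxP m) (ole_trans mi _).
  by apply: mP; exists i.
have [n] := fin.
elim: n (range chi) => [|n IH] A An.
  exists w0 => y Ay; have /card_eqPle[] := An; rewrite II0 => /card_le0P A0.
  by rewrite A0 in Ay.
have /eq_cardSP[x Ax /IH[m mP]] := An.
have [xm|mx] := ole_total x m.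
  by exists m => y Ay; have [->//|yx] := pselect (y = x); apply: mP; split.
exists x => y Ay; have [->|yx] := pselect (y = x); first exact: ole_refl.
by apply: ole_trans mx; apply: mP; split.
Qed.

Lemma cf_regular (W c : Card) :
  infinite_set [set: W] -> is_cf W c -> regular c.
Proof.
move=> Wi Wc; have ci := cf_infinite Wi Wc; split=> //.
have [w0 _] := infinite_setN0 Wi; have [chi [chim chicof]] := cf_cofinal_map w0 Wc.
split; first exact: card_initial.
  by exists [set: c] => // x; exists x => //; apply: ole_refl.
move=> a acof; have [_ _ minc] := Wc.
apply: card_le_trans (minc (chi @` a) _) (card_image_le _ _) => x.
have [i xi] := chicof x; have [j aj ij] := acof i.
by exists (chi j); [exists j|apply: ole_trans xi (chim _ _ ij)].
Qed.

Lemma lt_cf_bounded (W c : Card) (a : set W) : is_cf W c -> a #< [set: c] ->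
  exists x, forall y, a y -> olt y x.
Proof.
move=> [_ _ minc] /card_ltNge ac; apply: contrapT => nx; apply: ac; apply: minc.
move=> x; apply: contrapT => ny; apply: nx; exists x => y ay.
by apply/oleNlt => xy; apply: ny; exists y.
Qed.

(** A singular cardinal is no successor: if [m] were at most [d], a cofinal set of size less than
    [m], hence at most [c], would make [m] a union of [c] many segments of size at most [c]. *)
Lemma singular_succ_lt (m c d : Card) T (A : set T) : singular m ->
  A #< [set: m] -> [set: c] #= A -> is_succ c d -> [set: d] #< [set: m].
Proof.
move=> [mi [e me em]] Am cA cd; apply/card_ltNge => md.
have /card_eqPle[c1 c2] := cA.
have cm : [set: c] #< [set: m] := card_le_lt_trans c1 Am.
have dm : [set: d] #<= [set: m] by have [_ mind] := cd; apply: mind.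
have ci : infinite_set [set: c].
  move=> cf; have om : [set: omega] #< [set: m].
    apply: card_le_lt_trans em; apply/infiniteP; exact: cf_infinite mi me.
  have dom : [set: d] #<= [set: omega].
    by have [_ mind] := cd; apply: mind; apply: finite_lt_infinite => //; apply: infinite_nat.
  by apply: (@card_lt_irr _ [set: m]); apply: card_le_lt_trans md (card_le_lt_trans dom om).
have [_ [a acof ae] _] := me; have /card_eqPle[ae1 ae2] := ae.
have : a #<= [set: c].
  apply: lt_succ_le cd _; apply: card_le_lt_trans ae1 _.
  exact: card_lt_le_trans em md.
move=> ac; apply: (@card_lt_irr _ [set: m]); apply: card_le_lt_trans cm.
apply: card_le_trans (_ : _ #<= \bigcup_(x in a) [set y | ole y x]) _.
  by apply: subset_card_le => x _; have [y ay xy] := acof x; exists y.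
apply: bigcup_card_le => // x _; apply: lt_succ_le cd _.
exact: card_lt_le_trans (below_le_lt x mi) md.
Qed.

End InfiniteArithmetic.

(** * Club guessing *)

(** Least strict upper bound; for the empty set it is the least element. *)
Definition is_lsub (W : Ord) (A : set W) (x : W) : Prop :=
  (forall y, A y -> olt y x) /\ (forall z, olt z x -> exists2 y, A y & ole z y).

Lemma lsub_exists (W : Ord) (A : set W) :
  (exists x, forall y, A y -> olt y x) -> exists x, is_lsub A x.
Proof.
move=> /wo_least[x [Ax minx]]; exists x; split=> // z zx; apply: contrapT => ny.
suff /minx/oltNle : forall y, A y -> olt y z by [].
by move=> y Ay; apply/oleNlt => zy; apply: ny; exists y.
Qed.

Lemma is_lsub_uniq (W : Ord) (A : set W) x y : is_lsub A x -> is_lsub A y -> x = y.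
Proof.
have half u v : is_lsub A u -> is_lsub A v -> ole u v.
  move=> [_ Au] [Av _]; apply/oltNle => /Au[t At vt].
  exact: (olt_irr (olt_le_trans (Av t At) vt)).
by move=> Ax Ay; apply: ole_anti; apply: half.
Qed.

(** These sets stand in for clubs. Enlarging [g] shrinks the set, so intersections of clubs are
    handled by pointwise upper bounds of functions. *)
Definition closure_pts (W : Ord) (g : W -> W) : set W :=
  [set i | forall j, olt j i -> olt (g j) i].

Lemma closure_pts_anti (W : Ord) (g g' : W -> W) :
  (forall x, ole (g x) (g' x)) -> closure_pts g' `<=` closure_pts g.
Proof. by move=> gg' i gi j ji; apply: ole_lt_trans (gg' j) (gi j ji). Qed.

Lemma closure_pts_unbounded (d : Card) (g : d -> d) : regular d ->
  [set: nat] #< [set: d] -> forall x, exists2 i, closure_pts g i & olt x i.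
Proof.
move=> dreg natd x; have [di _] := dreg.
have /choice[f fP] : forall y : d, exists z,
    olt y z /\ forall j, ole j y -> olt (g j) z.
  move=> y; have [|z zP] := @regular_bounded d (y |` g @` [set j | ole j y]) dreg.
    apply: card_le_lt_trans (_ : _ #<= y |` g @` [set j | ole j y]) _ => //.
    rewrite -bigcup2E; apply: regular_bigcup_lt => //.
    move=> [|[|n]] _ /=.
    - exact: finite_lt_infinite.
    - by apply: card_le_lt_trans (card_image_le _ _) _; apply: below_le_lt.
    - exact: finite_lt_infinite.
  by exists z; split=> [|j jy]; apply: zP; [left|right; exists j].
pose s := fix s n := if n is n'.+1 then f (s n') else x.
have [|i [is1 is2]] := @lsub_exists d (range s).
  apply: regular_bounded => //; exact: card_le_lt_trans (card_image_le _ _) natd.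
exists i; last by apply: is1; exists 0.
move=> j /is2[_ [n _ <-] jn].
apply: olt_trans (_ : olt (s n.+1) i); last by apply: is1; exists n.+1.
exact: (fP (s n)).2.
Qed.

(** A supremum of closure points is a closure point, which applies to those up to [b]. *)
Lemma closure_pts_floor (W : Ord) (g : W -> W) (b : W) : exists m,
  [/\ closure_pts g m, ole m b &
      forall k, closure_pts g k -> ole k b -> ole k m].
Proof.
have [|m [mub minm]] := @wo_least W
    (fun m => forall k, closure_pts g k -> ole k b -> ole k m).
  by exists b.
exists m; split=> //; last exact: minm.
move=> j jm; apply: contrapT => nlt.
suff /minm/oltNle : forall k, closure_pts g k -> ole k b -> ole k j by [].
move=> k gk kb; apply/oltNle => jk; apply: nlt.
exact: olt_le_trans (gk j jk) (mub k gk kb).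
Qed.

Definition cofinal_in (W : Ord) (al : W) (V : set W) : Prop :=
  V `<=` below al /\ forall x, olt x al -> exists2 y, V y & ole x y.

(** Shelah's club guessing at points of cofinality [tau]. If every candidate fails, it is corrected
    [tau1] many times; at a suitable [al] the corrections stabilize, because the cofinal set [B al]
    has only [tau] points, and this contradicts the failure. *)
Lemma club_guessing (tau tau1 eta : Card) :
  regular tau -> is_succ tau tau1 -> is_succ tau1 eta ->
  exists C : eta -> set eta, forall g : eta -> eta, exists al : eta,
    [/\ C al `<=` closure_pts g, cofinal_in al (C al) &
        forall V, cofinal_in al V -> [set: tau] #<= V].
Proof.
move=> tau_reg tau1S etaS; have [taui _] := tau_reg.
have tau1i := succ_infinite taui tau1S.
have tau1_reg := succ_regular taui tau1S.
have eta_reg := succ_regular tau1i etaS; have [etai _] := eta_reg.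
have lt1 : [set: tau] #< [set: tau1] by case: tau1S.
have lt2 : [set: tau1] #< [set: eta] by case: etaS.
have tau_eta := card_lt_le_trans lt1 (card_ltW lt2).
have nat_eta : [set: nat] #< [set: eta].
  apply: card_le_lt_trans tau_eta; exact/infiniteP.
have [x0 _] := infinite_setN0 etai.
have /choice[B BP] : forall al : eta, exists B : set eta,
    (exists2 V, cofinal_in al V & V #<= [set: tau]) ->
    cofinal_in al B /\ B #<= [set: tau].
  move=> al; have [[V V1 V2]|nV] :=
      pselect (exists2 V, cofinal_in al V & V #<= [set: tau]); last by exists set0.
  by exists V.
have /choice[fl flP] : forall p : (eta -> eta) * eta, exists m,
    [/\ closure_pts p.1 m, ole m p.2 &
      forall k, closure_pts p.1 k -> ole k p.2 -> ole k m].
  by move=> p; apply: closure_pts_floor.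
(* The candidate attached to [g]: each point of [B al] is lowered to the largest closure point of
   [g] up to it. *)
pose C (g : eta -> eta) al := [set fl (g, b) | b in B al].
apply: contrapT => nguess.
have /choice[nxt nxtP] : forall g, exists g', forall al,
    ~ [/\ C g al `<=` closure_pts g', cofinal_in al (C g al) &
        forall V, cofinal_in al V -> [set: tau] #<= V].
  move=> g; apply: contrapT => ng; apply: nguess; exists (C g) => g'.
  apply: contrapT => nal; apply: ng; exists g' => al alP.
  by apply: nal; exists al.
have bnd (I : Type) (D : set I) (G : I -> eta) : D #<= [set: tau1] ->
    exists y, forall i, D i -> ole (G i) y.
  move=> D1; have [|y yP] := @regular_bounded eta (G @` D) eta_reg.
    exact: card_le_lt_trans (card_image_le _ _) (card_le_lt_trans D1 lt2).
  by exists y => i Di; apply: olt_ole; apply: yP; exists i.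
(* [G z] dominates every earlier [G y] and its counterexample [nxt (G y)], so the closure points of
   [G z] shrink as [z] grows. *)
have [||G GP] := @wo_rec tau1 (eta -> eta) id (fun z G t =>
    forall y, olt y z -> forall x, ole (G y x) (t x) /\ ole (nxt (G y) x) (t x)).
- by move=> i f g t fg h y yi x; rewrite -fg//; apply: h.
- move=> z G _.
  have /choice[t tP] : forall x, exists v, forall y, olt y z ->
      ole (G y x) v /\ ole (nxt (G y) x) v.
    move=> x; have bz : below z #<= [set: tau1] := card_leT _.
    have [v1 v1P] := bnd _ _ (fun y => G y x) bz.
    have [v2 v2P] := bnd _ _ (fun y => nxt (G y) x) bz.
    have [v12|v21] := ole_total v1 v2; [exists v2|exists v1] => y yz; split.
    + exact: ole_trans (v1P y yz) v12.
    + exact: v2P.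
    + exact: v1P.
    + exact: ole_trans (v2P y yz) v21.
  by exists t => y yz x; apply: tP.
have /choice[gi giP] : forall x, exists v, forall z, ole (G z x) v.
  move=> x; have [v vP] := bnd _ [set: tau1] (fun z => G z x) (card_lexx _).
  by exists v => z; apply: vP.
have giE z : closure_pts gi `<=` closure_pts (G z).
  by apply: closure_pts_anti => x; apply: giP.
have GE y z : olt y z -> closure_pts (G z) `<=` closure_pts (G y).
  by move=> yz; apply: closure_pts_anti => x; have [] := GP z y yz x.
have GN y z : olt y z -> closure_pts (G z) `<=` closure_pts (nxt (G y)).
  by move=> yz; apply: closure_pts_anti => x; have [] := GP z y yz x.
(* An increasing sequence of [tau] many closure points of [gi]; its supremum is the [al] at which
   the contradiction arises. *)
have [||h hP] := @wo_rec tau eta x0 (fun t h v =>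
    closure_pts gi v /\ forall s, olt s t -> olt (h s) v).
- by move=> i f g t fg [h1 h2]; split=> // s si; rewrite -fg//; apply: h2.
- move=> t h _; have [|v vP] := @regular_bounded eta (h @` below t) eta_reg.
    apply: card_le_lt_trans (card_image_le _ _) _.
    exact: card_le_lt_trans (card_leT _) tau_eta.
  have [w gw vw] := closure_pts_unbounded gi eta_reg nat_eta v.
  exists w; split=> // s st; apply: olt_trans vw; apply: vP; by exists s.
have hinc s t : olt s t -> olt (h s) (h t) by move=> st; apply: (hP t).2.
have [|al [al1 al2]] := @lsub_exists eta (range h).
  apply: regular_bounded => //; exact: card_le_lt_trans (card_image_le _ _) tau_eta.
have [|[Bal Bcof] Btau] := BP al.
  exists (range h); last exact: card_image_le.
  by split=> [y /al1//|x /al2].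
have big V : cofinal_in al V -> [set: tau] #<= V.
  move=> [Val Vcof].
  have /choice[k kP] : forall v, exists t, V v -> ole v (h t) /\
      forall s, ole v (h s) -> ole t s.
    move=> v; have [Vv|nVv] := pselect (V v); last first.
      by have [t0 _] := infinite_setN0 taui; exists t0.
    have [|t [t1 t2]] := @wo_least tau (fun t => ole v (h t)); last by exists t.
    by have [_ [t _ <-] vt] := al2 v (Val v Vv); exists t.
  apply: card_le_trans (_ : _ #<= k @` V) (card_image_le _ _).
  apply: regular_unbounded_card => // t.
  have [t' tt'] := card_no_max taui t.
  have [|v Vv hv] := Vcof (h t'); first by apply: al1; exists t'.
  exists (k v); first by exists v.
  apply: olt_ole; apply: olt_le_trans tt' _; apply/oltNle => kt'.
  have [vk _] := kP v Vv; have := hinc _ _ kt'.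
  by move=> /(ole_lt_trans (ole_trans hv vk)) /olt_irr.
(* The floors of [b] never increase with [z], hence are constant from [ze b] on. *)
have /choice[ze zeP] : forall b, exists z : tau1, B al b ->
    forall y, ole (fl (G z, b)) (fl (G y, b)).
  move=> b; have [z0 _] := infinite_setN0 tau1i.
  have [|m [[z <-] minm]] := @wo_least eta (fun m => exists z, fl (G z, b) = m).
    by exists (fl (G z0, b)), z0.
  by exists z => _ y; apply: minm; exists y.
have [|z zP] := @regular_bounded tau1 (ze @` B al) tau1_reg.
  exact: card_le_lt_trans (card_image_le _ _) (card_le_lt_trans Btau lt1).
have [z2 zz2] := card_no_max tau1i z.
have flmon y y' b : olt y y' -> ole (fl (G y', b)) (fl (G y, b)).
  move=> yy'; have [f1 f2 _] := flP (G y', b); have [_ _] := flP (G y, b).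
  apply=> //; exact: GE yy' _ _.
(* Beyond [z] no floor moves, so the candidate of [G z] at [al] equals that of [G z2] and lies in
   the closure points of [nxt (G z)]. *)
apply: (nxtP (G z) al); split=> //.
- move=> _ [b Bb <-].
  have zz : olt (ze b) z by apply: zP; exists b.
  have -> : fl (G z, b) = fl (G z2, b).
    apply: ole_anti; last exact: flmon.
    exact: ole_trans (flmon _ _ _ zz) (zeP b Bb z2).
  apply: GN zz2 _ _; by have [] := flP (G z2, b).
- split=> [_ [b Bb <-]|x xal].
    by have [_ le _] := flP (G z, b); apply: ole_lt_trans le (Bal b Bb).
  have [_ [t _ <-] xt] := al2 x xal.
  have [|b Bb tb] := Bcof (h t); first by apply: al1; exists t.
  exists (fl (G z, b)); first by exists b.
  apply: ole_trans xt _; have [_ _] := flP (G z, b); apply=> //.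
  by apply: giE; have [] := hP t.
Qed.

(** * Approachability matrices *)

(** Otherwise every piece is bounded below [al], and the bounds form a cofinal set of size at most
    that of [I]. *)
Lemma cofinal_in_split (W : Ord) (al : W) (V : set W) (I : Type) (f : W -> I) :
  cofinal_in al V -> (forall V', cofinal_in al V' -> ~ (V' #<= [set: I])) ->
  exists i, cofinal_in al [set j | V j /\ f j = i].
Proof.
move=> [Val Vcof] big; apply: contrapT => ncof.
have /choice[x xP] : forall i, exists x,
    olt x al /\ forall j, V j -> f j = i -> olt j x.
  move=> i; apply: contrapT => nx; apply: ncof; exists i.
  split=> [j [/Val]//|x xal]; apply: contrapT => nj; apply: nx; exists x.
  by split=> // j Vj fj; apply/oleNlt => xj; apply: nj; exists j.
apply: (big (range x)); last exact: card_image_le.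
split=> [_ [i _ <-]|z zal]; first by case: (xP i).
have [j Vj zj] := Vcof z zal; exists (x (f j)); first by exists (f j).
by apply: ole_trans zj _; apply: olt_ole; apply: (xP (f j)).2.
Qed.

Definition omax (W : Ord) (x y : W) : W := if ole x y then y else x.

Lemma ole_omaxl (W : Ord) (x y : W) : ole x (omax x y).
Proof. by rewrite /omax; case: ifP => // _; apply: ole_refl. Qed.

Lemma ole_omaxr (W : Ord) (x y : W) : ole y (omax x y).
Proof.
rewrite /omax; case: ifP => [_|/negP /oleNlt /olt_ole//]; exact: ole_refl.
Qed.

(** The continuity clause also covers the first index, where it forces the least element of [L]; two
    sequences thus agree there too. *)
Definition continuous_seq (eta L : Ord) (xi : eta -> L) (b : L) : Prop :=
  [/\ forall i j, olt i j -> olt (xi i) (xi j),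
      forall i, (forall j, olt j i -> exists2 k, olt j k & olt k i) ->
        is_lsub (xi @` below i) (xi i) &
      is_lsub (range xi) b].

(** The sequences interleave: [g j] bounds an index at which each has passed the other's value at
    [j]. Below a closure point of [g], which is a limit or the first index, they have the same
    supremum. *)
Lemma continuous_seq_agree (eta L : Ord) (xi e : eta -> L) (b : L) :
  continuous_seq xi b -> continuous_seq e b ->
  exists g : eta -> eta, forall i, closure_pts g i -> xi i = e i.
Proof.
move=> [xiinc xilim [xib xib']] [einc elim [eb eb']].
have /choice[g gP] : forall j, exists v, [/\ forall k, ole k j -> ole k v,
    (exists2 k, ole k v & ole (xi j) (e k)), (exists2 k, ole k v & ole (e j) (xi k)) &
    (exists k, olt j k) -> olt j v].
  move=> j.
  have [|_ [k1 _ <-] xk1] := eb' (xi j); first by apply: xib; exists j.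
  have [|_ [k2 _ <-] xk2] := xib' (e j); first by apply: eb; exists j.
  have [k3 [jk3 k3P]] : exists k3, ole j k3 /\ ((exists k, olt j k) -> olt j k3).
    have [[k jk]|nk] := pselect (exists k, olt j k).
      by exists k; split=> //; apply: olt_ole.
    by exists j; split=> //; apply: ole_refl.
  exists (omax k1 (omax k2 k3)).
  have k3le : ole k3 (omax k1 (omax k2 k3)).
    exact: ole_trans (ole_omaxr _ _) (ole_omaxr _ _).
  split.
  - by move=> k kj; apply: ole_trans (ole_trans kj jk3) k3le.
  - by exists k1 => //; apply: ole_omaxl.
  - by exists k2 => //; apply: ole_trans (ole_omaxl _ _) (ole_omaxr _ _).
  - by move=> /k3P jk; apply: olt_le_trans jk k3le.
exists g => i gi.
have lim j : olt j i -> exists2 k, olt j k & olt k i.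
  move=> ji; exists (g j); last exact: gi.
  by have [_ _ _] := gP j; apply; exists i.
have [xi1 xi2] := xilim i lim.
apply: is_lsub_uniq (_ : is_lsub (e @` below i) _) (elim i lim); split.
  move=> _ [j ji <-]; have [_ _ [k kg jk] _] := gP j.
  apply: ole_lt_trans jk _; apply: xiinc; exact: ole_lt_trans kg (gi j ji).
move=> z /xi2[_ [j ji <-] zj]; have [_ [k kg jk] _ _] := gP j.
exists (e k); last exact: ole_trans zj jk.
by exists k => //; apply: ole_lt_trans kg (gi j ji).
Qed.

(* The sets [D i b] play the role of an i-th approximation of b.  Club guessing
   makes every unbounded K contain a set of size tau along which all but
   boundedly many of the approximations are increasing. *)
Lemma approachability_matrix (lam L eps tau tau1 eta : Card) :
  singular lam -> is_succ lam L -> is_cf lam eps ->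
  regular tau -> is_succ tau tau1 -> is_succ tau1 eta ->
  [set: eps] #< [set: tau] -> [set: eta] #< [set: lam] ->
  exists D : eps -> L -> set L,
  [/\ forall i b, D i b #< [set: lam],
      forall i b, D i b b,
      forall a b, olt a b -> exists i0, forall i, ole i0 i -> D i a `<=` D i b &
      forall K : set L, cofinal K -> exists X i0,
        [/\ X `<=` K, [set: tau] #<= X,
            forall a, X a -> exists2 b, X b & olt a b &
            forall i a b, ole i0 i -> X a -> X b -> olt a b -> D i a `<=` D i b]].
Proof.
move=> lam_sing LS lam_eps tau_reg tau1S etaS eps_tau eta_lam.
have [lami _] := lam_sing; have [taui _] := tau_reg.
have tau1i := succ_infinite taui tau1S; have etai := succ_infinite tau1i etaS.
have L_reg := succ_regular lami LS; have [Li _] := L_reg.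
have lam_L : [set: lam] #< [set: L] by case: LS.
have eta_L := card_lt_le_trans eta_lam (card_ltW lam_L).
have [x0 _] := infinite_setN0 lami; have [b0 _] := infinite_setN0 Li.
have [chi [chim chicof]] := cf_cofinal_map x0 lam_eps.
have [p /card_eqPle[_ peta]] := card_lt_below eta_lam.
(* Each bound is raised to have at least [eta] points below it, so that the [eta] many points of
   [E b] do not spoil the size of [D i b]. *)
pose chi' i := omax (chi i) p.
have N_eta i : [set: eta] #<= below (chi' i).
  apply: card_le_trans peta (subset_card_le _) => t tp.
  exact: olt_le_trans tp (ole_omaxr _ _).
have Ni i : infinite_set (below (chi' i)) := infinite_card_le (N_eta i) etai.
have /choice[e eP] : forall b : L, exists e : L -> lam,
    forall x y, olt x b -> olt y b -> e x = e y -> x = y.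
  move=> b; have [e [_ einj]] := card_leEinj x0 (below_succ_le b LS).
  by exists e.
(* Each predecessor of [b] enters [bi i b] from some [i] on, which makes [D] increasing modulo an
   initial part of the indices. *)
pose bi i b := [set a | olt a b /\ olt (e b a) (chi' i)].
have bi_card i b : bi i b #<= below (chi' i).
  apply: (@card_le_inj _ _ _ _ (e b)) => [x []//|x y [xb _] [yb _]].
  exact: eP.
have /choice[E EP] : forall b : L, exists E : set L,
    E #<= [set: eta] /\ ((exists xi : eta -> L, continuous_seq xi b) ->
      exists2 xi : eta -> L, continuous_seq xi b & E = range xi).
  move=> b; have [[xi xib]|nxi] :=
      pselect (exists xi : eta -> L, continuous_seq xi b); last first.
    by exists set0; split=> //; apply: card_ge0.
  by exists (range xi); split; [exact: card_image_le|exists xi].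
have [||D0 D0P] := @wo_rec L (eps -> set L) (fun=> set0) (fun b F t =>
    forall i x, t i x <-> x = b \/ exists a,
      [/\ bi i b a \/ E b a, olt a b & F a i x]).
- move=> b f g t fg tP i x; rewrite tP; split=> -[->|[a [h1 h2 h3]]]; try by left.
    by right; exists a; rewrite -fg.
  by right; exists a; rewrite fg.
- move=> b F _; exists (fun i => [set x | x = b \/ exists a,
      [/\ bi i b a \/ E b a, olt a b & F a i x]]) => i x.
  by [].
pose D i b := D0 b i.
have DP i b x : D i b x <-> x = b \/ exists a,
    [/\ bi i b a \/ E b a, olt a b & D i a x] := D0P b i x.
have Dself i b : D i b b by apply/DP; left.
have Dcard i b : D i b #<= below (chi' i).
  move: b; apply: olt_ind => b IH.
  pose S := (bi i b `|` E b) `&` below b.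
  apply: card_le_trans (_ : _ #<= b |` \bigcup_(a in S) D i a) _.
    apply: subset_card_le => x /DP[->|[a [h1 h2 h3]]]; first by left.
    by right; exists a.
  apply: infinite_setU_le => //.
    by apply: card_ltW; apply: finite_lt_infinite.
  apply: bigcup_card_le => //; last by move=> a [_ /IH].
  apply: card_le_trans (subset_card_le (@subIsetl _ _ _)) _.
  apply: infinite_setU_le => //.
  exact: card_le_trans (EP b).1 (N_eta i).
have Dmon a b : olt a b -> exists i0, forall i, ole i0 i -> D i a `<=` D i b.
  move=> ab; have [y ey] := card_no_max lami (e b a).
  have [i0 yi0] := chicof y; exists i0 => i i0i x Dx; apply/DP; right.
  exists a; split=> //; left; split=> //; apply: olt_le_trans ey _.
  exact: ole_trans yi0 (ole_trans (chim _ _ i0i) (ole_omaxl _ _)).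
exists D; split=> //.
  by move=> i b; apply: card_le_lt_trans (Dcard i b) (card_initial _).
move=> K Kcof.
have [C CP] := club_guessing tau_reg tau1S etaS.
have /choice[ls lsP] : forall A : set L, exists x,
    (exists x, forall y, A y -> olt y x) -> is_lsub A x.
  move=> A; have [/lsub_exists[x Ax]|n] :=
    pselect (exists x, forall y, A y -> olt y x); by [exists x|exists b0].
(* [xi s] is the continuous closure of the sequence [s], whose own values will stay in [K]. *)
pose xi (s : eta -> L) k := ls (s @` below k).
have xiloc f g j : (forall l, olt l j -> f l = g l) ->
    forall k, ole k j -> xi f k = xi g k.
  move=> fg k kj; congr (ls _); apply: eq_imagel => l lk; apply: fg.
  exact: olt_le_trans lk kj.
(* [y] passes if it contains, for every index at once, the approximations along the guess [C al] up
   to [j]. *)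
pose test (s : eta -> L) al j y := forall i' c, C al c -> ole c j ->
  D i' (xi s c) `<=` D i' y.
have testloc f g al j y : (forall l, olt l j -> f l = g l) ->
    test f al j y -> test g al j y.
  move=> fg fy i' c Cc cj; rewrite -(xiloc f g j fg c cj); exact: fy.
have etabnd (I : Type) (Q : set I) (s : I -> L) : Q #<= [set: eta] ->
    exists x, forall y, (s @` Q) y -> olt y x.
  move=> Qe; apply: regular_bounded => //.
  exact: card_le_lt_trans (card_image_le _ _) (card_le_lt_trans Qe eta_L).
(* For each of the [eta] many [al] whose test can be passed at all, [s j] is taken beyond some [y]
   passing it. *)
have [||s sP] := @wo_rec eta L b0 (fun j s v => [/\ K v, ole (xi s j) v &
    forall al, (exists y, test s al j y) -> exists2 y, test s al j y & ole y v]).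
- move=> j f g t fg [h1 h2 h3]; split=> //.
    by rewrite -(xiloc f g j fg j (ole_refl j)).
  have gf l : olt l j -> g l = f l by move/fg.
  move=> al [y ty]; have [|y' ty' y't] := h3 al; first by exists y; apply: testloc ty.
  by exists y' => //; apply: testloc ty'.
- move=> j s _.
  have /choice[y yP] : forall al, exists y,
      (exists y, test s al j y) -> test s al j y.
    move=> al; have [[y ty]|n] := pselect (exists y, test s al j y).
      by exists y.
    by exists b0.
  have [v vP] := etabnd _ [set: eta] y (card_lexx _).
  have [w Kw vw] := Kcof (omax v (xi s j)); exists w; split=> //.
    exact: ole_trans (ole_omaxr _ _) vw.
  move=> al /yP ty; exists (y al) => //.
  apply: ole_trans (ole_trans (ole_omaxl _ _) vw); apply: olt_ole; apply: vP.
  by exists al.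
have xiP k : is_lsub (s @` below k) (xi s k).
  by apply: lsP; apply: etabnd; apply: card_leT.
have sxi l k : olt l k -> olt (s l) (xi s k).
  by move=> lk; apply: (xiP k).1; exists l.
have xis k : ole (xi s k) (s k) by have [] := sP k.
have sinc l k : olt l k -> olt (s l) (s k).
  by move=> lk; apply: olt_le_trans (sxi l k lk) (xis k).
have sinj l k : s l = s k -> l = k.
  move=> e1; apply: contrapT => nlk; have [lk|kl] := ole_total l k.
    by apply: (@olt_irr L (s l)); rewrite {2}e1; apply: sinc; apply: olt_neq.
  apply: (@olt_irr L (s l)); rewrite {1}e1; apply: sinc; apply: olt_neq => // e2.
  by apply: nlk.
have slt l k : olt (s l) (s k) -> olt l k.
  move=> lk; apply/oleNlt => kl; apply: (@olt_irr L (s l)).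
  have [e1|nkl] := pselect (k = l); first by rewrite e1 in lk.
  by apply: olt_trans lk _; apply: sinc; apply: olt_neq.
have [dl dlP] := lsub_exists (etabnd _ [set: eta] (xi s) (card_lexx _)).
have xic : continuous_seq (xi s) dl.
  split=> // [i j ij|i lim]; first exact: ole_lt_trans (xis i) (sxi i j ij).
  split=> [_ [j ji <-]|z /(xiP i).2[_ [j ji <-] zj]].
    exact: ole_lt_trans (xis j) (sxi j i ji).
  have [k jk ki] := lim j ji; exists (xi s k); first by exists k.
  exact: ole_trans zj (olt_ole (sxi j k jk)).
(* [E dl] is the range of a possibly different sequence converging to [dl]; it agrees with [xi s] on
   the closure points of [g], hence on the guess. *)
have [e' e'c Edl] := (EP dl).2 (ex_intro (fun f => continuous_seq f dl) _ xic).
have [g gP] := continuous_seq_agree xic e'c.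
have [al [Calg Calc big]] := CP g.
(* The limit [dl] itself passes, so some [y] up to [s j] already does. *)
have tests j : test s al j dl.
  move=> i' c Cc _ x Dx; apply/DP; right; exists (xi s c); split=> //.
    by right; rewrite Edl (gP c (Calg c Cc)); exists c.
  by apply: dlP.1; exists c.
have nomax j : olt j al -> exists2 k, olt j k & olt k al.
  move=> jal; apply: contrapT => nk.
  suff /big : cofinal_in al [set j].
    by move=> /infinite_card_le /(_ taui); apply.
  split=> [_ ->//|x xal]; exists j => //; apply/oltNle => jx; apply: nk.
  by exists x.
have /choice[nx nxP] : forall j, exists k, C al j ->
    [/\ C al k, olt j k & forall l, C al l -> olt j l -> ole k l].
  move=> j; have [Cj|nCj] := pselect (C al j); last by exists j.
  have [|k [[Ck jk] kmin]] := @wo_least eta (fun k => C al k /\ olt j k).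
    have [k jk kal] := nomax j (Calc.1 j Cj).
    by have [l Cl kl] := Calc.2 k kal; exists l; split=> //; apply: olt_le_trans jk kl.
  by exists k => _; split=> // l Cl jl; apply: kmin.
(* From [i0 j] on, inclusions lead from the guess up to [j] through [y] into [s j], and on to the
   next point of the guess. *)
have /choice[i0 i0P] : forall j, exists i0, C al j -> forall i, ole i0 i ->
    (forall c, C al c -> ole c j -> D i (xi s c) `<=` D i (s j)) /\
    D i (s j) `<=` D i (xi s (nx j)).
  move=> j; have [i1 _] := chicof x0.
  have [Cj|nCj] := pselect (C al j); last by exists i1.
  have [_ _ sj] := sP j.
  have [y ty ys] := sj al (ex_intro (test s al j) _ (tests j)).
  have [_ jnx _] := nxP j Cj; have [i2 i2P] := Dmon _ _ (sxi _ _ jnx).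
  have [i3 i3P] : exists i3, forall i, ole i3 i -> D i y `<=` D i (s j).
    have [->|nys] := pselect (y = s j); first by exists i1 => i _.
    by have [i3 i3P] := Dmon _ _ (olt_neq ys nys); exists i3.
  exists (omax i2 i3) => _ i ii; split=> [c Cc cj x Dx|].
    apply: i3P (ty i c Cc cj x Dx); exact: ole_trans (ole_omaxr _ _) ii.
  apply: i2P; exact: ole_trans (ole_omaxl _ _) ii.
(* The cofinality of [al] is at least [tau] and exceeds [eps], so [i0] is constant on a cofinal part
   of the guess. *)
have [|ii Ccof] := cofinal_in_split i0 Calc.
  move=> V /big tV Ve; apply: (@card_lt_irr _ [set: tau]).
  exact: card_le_lt_trans (card_le_trans tV Ve) eps_tau.
pose C' := [set j | C al j /\ i0 j = ii].
exists (s @` C'), ii; split.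
- by move=> _ [j _ <-]; have [] := sP j.
- apply: card_le_trans (big _ Ccof) _.
  by apply: (@card_le_inj _ _ _ _ s) => [j Cj|j k _ _ /sinj]; first by exists j.
- move=> _ [j Cj <-]; have [k jk kal] := nomax j (Ccof.1 j Cj).
  have [l Cl kl] := Ccof.2 k kal; exists (s l); first by exists l.
  by apply: sinc; apply: olt_le_trans jk kl.
- move=> i _ _ iii [j [Cj ij] <-] [k [Ck ik] <-] /slt jk x Dx.
  have [Cn jn nmin] := nxP j Cj.
  have [|h1 h2] := i0P j Cj i; first by rewrite ij.
  have [|h3 h4] := i0P k Ck i; first by rewrite ik.
  by apply: (h3 (nx j)) => //; [apply: nmin|apply: h2].
Qed.

(** * Covering countable sets at cardinals of countable cofinality *)

Lemma is_cf_eq (W c c' : Card) : is_cf W c -> [set: c] #= [set: c'] -> is_cf W c'.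
Proof.
move=> [ci [a acof ac] minc] cc'; split; first exact: card_initial.
  by exists a => //; apply: card_eq_trans ac cc'.
by move=> b /minc; apply: card_le_trans; have /card_eqPle[] := cc'.
Qed.

(** If the traces on [z] never stabilize, let [nxt] lead to a later change and [K] be its closure
    points. Along [X], each step from [a] to [nx a] adds a pair of an index and a point of [z]; by
    monotonicity no pair is added twice, so [X] would be smaller than [kappa]. *)
Lemma matrix_stabilizes (kappa L : Card) (D : omega -> L -> set L) (z : set L) :
  regular kappa -> regular L -> [set: nat] #< [set: kappa] ->
  [set: nat] #< [set: L] ->
  (forall a b, olt a b -> exists i0, forall i, ole i0 i -> D i a `<=` D i b) ->
  (forall K : set L, cofinal K -> exists X i0,
        [/\ X `<=` K, [set: kappa] #<= X,
            forall a, X a -> exists2 b, X b & olt a b &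
            forall i a b, ole i0 i -> X a -> X b -> olt a b -> D i a `<=` D i b]) ->
  z #< [set: kappa] ->
  exists b0, forall b, ole b0 b -> exists n : nat, forall m, n <= m ->
    forall x, z x -> (D m b x <-> D m b0 x).
Proof.
move=> kreg Lreg natk natL Dmon DK zk; apply: contrapT => nst.
have /choice[nxt nxtP] : forall b0, exists b, ole b0 b /\
    ~ exists n : nat, forall m, n <= m -> forall x, z x -> (D m b x <-> D m b0 x).
  move=> b0; apply: contrapT => nb; apply: nst; exists b0 => b b0b.
  by apply: contrapT => nn; apply: nb; exists b.
have [|X [i0 [XK kX Xnomax Xmon]]] := DK (closure_pts nxt).
  move=> x; have [i ci xi] := closure_pts_unbounded nxt Lreg natL x.
  by exists i => //; apply: olt_ole.
have /choice[nx nxP] : forall a, exists b, X a ->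
    [/\ X b, olt a b & forall c, X c -> olt a c -> ole b c].
  move=> a; have [Xa|nXa] := pselect (X a); last by exists a.
  have [|b [[Xb ab] bmin]] := @wo_least L (fun b => X b /\ olt a b).
    by have [b Xb ab] := Xnomax a Xa; exists b.
  by exists b => _; split=> // c Xc ac; apply: bmin.
have XZ : X #<= [set: nat] `*` z.
  apply: (@card_le_rel _ _ _ _ (fun a p =>
    [/\ ole i0 (p.1 : omega), z p.2, D p.1 (nx a) p.2 & ~ D p.1 a p.2])).
    move=> a Xa; apply: contrapT => np; have [Xn an nmin] := nxP a Xa.
    have [an1 nn] := nxtP a; apply: nn.
    have an2 : olt (nxt a) (nx a) by apply: XK.
    have [n1 n1P] : exists n1 : omega, forall m, ole n1 m -> D m a `<=` D m (nxt a).
      have [<-|ne] := pselect (a = nxt a); first by exists i0 => m _.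
      by apply: Dmon; apply: olt_neq.
    have [n2 n2P] := Dmon _ _ an2.
    exists (maxn i0 (maxn n1 n2)) => m; rewrite !geq_max => /and3P[m0 m1 m2] x zx.
    split=> [Dx|]; last exact: n1P.
    apply: contrapT => nDx; apply: np; exists (m, x); split=> //=.
    exact: n2P Dx.
  have half a a' p : X a -> X a' ->
      [/\ ole i0 (p.1 : omega), z p.2, D p.1 (nx a) p.2 & ~ D p.1 a p.2] ->
      [/\ ole i0 (p.1 : omega), z p.2, D p.1 (nx a') p.2 & ~ D p.1 a' p.2] -> ~ olt a a'.
    move=> Xa Xa' [i0p zp Dp nDp] [_ _ _ nDp'] aa'; apply: nDp'.
    have [Xn an nmin] := nxP a Xa; have le := nmin a' Xa' aa'.
    have [<-//|ne] := pselect (nx a = a').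
    by apply: (Xmon _ (nx a)) => //; apply: olt_neq.
  move=> a a' p Xa Xa' h h'; apply: ole_anti; apply/oltNle.
    exact: half h' h.
  exact: half h h'.
apply: (@card_lt_irr _ [set: kappa]); apply: card_le_lt_trans (card_le_trans kX XZ) _.
have sub : [set: nat] `*` z `<=` \bigcup_(n in [set: nat]) (pair n @` z).
  by move=> [n x] [_ /= zx]; exists n => //; exists x.
apply: card_le_lt_trans (subset_card_le sub) _; apply: regular_bigcup_lt => // n _.
exact: card_le_lt_trans (card_image_le _ _) zk.
Qed.

(** The matrix is taken with increasing subsequences of size [kappa]; its stable traces form a
    system on [L], where [pi] codes pairs of an index and a point. *)
Lemma cNSP_countable_cover (kappa omega1 omega2 lam L : Card) :
  is_succ omega omega1 -> is_succ omega1 omega2 ->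
  [set: omega2] #<= [set: kappa] -> regular kappa -> cNSP kappa ->
  singular lam -> [set: kappa] #< [set: lam] -> is_cf lam omega ->
  is_succ lam L ->
  exists P : L -> set lam, (forall b, P b #< [set: lam]) /\
    forall y : set lam, y #<= [set: nat] -> exists b, y `<=` P b.
Proof.
move=> o1 o2 o2k kreg nsp lam_sing klam cflam LS.
have [lami _] := lam_sing; have [ki _] := kreg.
have L_reg := succ_regular lami LS; have [Li _] := L_reg.
have lamL : [set: lam] #< [set: L] by case: LS.
have natk : [set: omega] #< [set: kappa].
  have [h1 _] := o1; have [h2 _] := o2.
  exact: card_lt_le_trans h1 (card_le_trans (card_ltW h2) o2k).
have natL : [set: nat] #< [set: L].
  exact: card_lt_le_trans natk (card_le_trans (card_ltW klam) (card_ltW lamL)).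
have [k1 k1S] := succ_exists kappa; have [eta etaS] := succ_exists k1.
have k1lam := singular_succ_lt lam_sing klam (card_eqxx _) k1S.
have etalam := singular_succ_lt lam_sing k1lam (card_eqxx _) etaS.
have [D [Dcard Dself Dmon DK]] :=
  approachability_matrix lam_sing LS cflam kreg k1S etaS natk etalam.
have stab z : z #< [set: kappa] -> exists b0, forall b, ole b0 b ->
    exists n : nat, forall m, n <= m -> forall x, z x -> (D m b x <-> D m b0 x).
  exact: matrix_stabilizes.
have [b0 _] := infinite_setN0 Li.
have [|pi [_ piinj']] := @card_leEinj _ _ b0 ([set: nat] `*` [set: L]) [set: L].
  by apply: infinite_setX_le => //; apply: card_ltW.
have piinj p q : pi p = pi q -> p = q by apply: piinj'.
pose zx (x : set L) := [set c | exists m, x (pi (m, c))].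
have zxk x : x #< [set: kappa] -> zx x #< [set: kappa].
  apply: card_le_lt_trans.
  apply: (@card_le_rel _ _ _ _ (fun c p => exists m, p = pi (m, c))).
    by move=> c [m xm]; exists (pi (m, c)) => //; exists m.
  by move=> c c' p _ _ [m ->] [m' /piinj[]].
have /choice[bx bxP] : forall x : set L, exists b0, x #< [set: kappa] ->
    forall b, ole b0 b -> exists n : nat, forall m, n <= m ->
    forall c, zx x c -> (D m b c <-> D m b0 c).
  move=> x; have [xk|nxk] := pselect (x #< [set: kappa]); last by exists b0.
  by have [b bP] := stab _ (zxk x xk); exists b.
(* The stable trace on [x] with the indices below [n] cut off; varying [n] absorbs the finite
   ambiguity and keeps the width countable. *)
pose t x n := [set p | x p /\ exists m c, [/\ p = pi (m, c), n <= m & D m (bx x) c]].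
pose A := Pk kappa L; pose S x := range (t x).
have sys : concrete_system kappa A S.
  split.
  - by split=> // x xk; exists x.
  - move=> x Ax; split; first by exists (t x 0), 0.
    by move=> _ [n _ <-] p [].
  - move=> x y Ax Ay xy.
    (* Both traces are compared with the one at the larger of [bx x] and [bx y]; beyond [n1] and
       [n2] they agree on the pairs coded in [x]. *)
    have [n1 n1P] := bxP x Ax _ (ole_omaxl (bx x) (bx y)).
    have [n2 n2P] := bxP y Ay _ (ole_omaxr (bx x) (bx y)).
    exists (t y (maxn n1 n2)); first by exists (maxn n1 n2).
    exists (maxn n1 n2) => //; apply/seteqP; split=> p.
      move=> [xp [m [c [pE nm Dc]]]]; split=> //; split; first exact: xy.
      exists m, c; split=> //; move: nm; rewrite geq_max => /andP[nm1 nm2].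
      have zc : zx x c by exists m; rewrite -pE.
      have zc' : zx y c by exists m; rewrite -pE; apply: xy.
      by apply/n2P => //; apply/n1P.
    move=> [[yp [m [c [pE nm Dc]]]] xp]; split=> //.
    exists m, c; split=> //; move: nm; rewrite geq_max => /andP[nm1 nm2].
    have zc : zx x c by exists m; rewrite -pE.
    have zc' : zx y c by exists m; rewrite -pE; apply: xy.
    by apply/n1P => //; apply/n2P.
have nar : narrow kappa A S.
  pose ub (w : Card) := forall c : Card, (exists2 x, A x & [set: c] #= S x) ->
    [set: c] #<= [set: w].
  have ubo : ub omega.
    move=> c [x _ /card_eqPle[cS _]]; apply: card_le_trans cS _.
    exact: card_image_le.
  have [|w [ubw minw]] := @least_card ub; first by exists omega.
  have [w' w'S] := succ_exists w; exists w, w'; split=> //.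
  have [_ minw'] := w'S; have [h1 _] := o1; have [h2 _] := o2.
  apply: card_le_lt_trans (minw' omega1 _) (card_lt_le_trans h2 o2k).
  exact: card_le_lt_trans (minw _ ubo) h1.
have kL : [set: kappa] #<= [set: L].
  exact: card_le_trans (card_ltW klam) (card_ltW lamL).
have [b [_ bcof]] := nsp L kL A S sys nar.
(* One cut-off [n] serves cofinally many [x]: otherwise the counterexamples [y n] have a union of
   size below [kappa], which some [x] on the branch contains. *)
have [n nP] : exists n, forall y, y #< [set: kappa] ->
    exists x, [/\ A x, y `<=` x & b `&` x = t x n].
  apply: contrapT => nn.
  have /choice[y yP] : forall n, exists y, y #< [set: kappa] /\
      ~ exists x, [/\ A x, y `<=` x & b `&` x = t x n].
    move=> n; apply: contrapT => ny; apply: nn; exists n => y yk.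
    by apply: contrapT => nx; apply: ny; exists y.
  have [|x [Ax [n _ tn]] yx] := bcof (\bigcup_n y n).
    by apply: regular_bigcup_lt => // n _; have [] := yP n.
  have [_] := yP n; apply; exists x; split=> //.
  by move=> c yc; apply: yx; exists n.
pose B m := [set c | b (pi (m, c))].
(* [c] lies in [D m c], hence in [D m d] for a later [d] and all large [m], and therefore in the
   stable trace. *)
have Bcov c : exists2 m, n <= m & B m c.
  have [|x [Ax yx bx_]] := nP [set pi (m, c) | m in [set: nat]].
    exact: card_le_lt_trans (card_image_le _ _) natk.
  have [d cd] := card_no_max Li (omax c (bx x)).
  have cd1 : olt c d := ole_lt_trans (ole_omaxl _ _) cd.
  have cd2 : ole (bx x) d := olt_ole (ole_lt_trans (ole_omaxr _ _) cd).
  have [m1 m1P] := Dmon _ _ cd1; have [m2 m2P] := bxP x Ax d cd2.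
  pose m := maxn n (maxn m1 m2).
  have nm : n <= m by rewrite leq_maxl.
  have m1m : m1 <= m by rewrite !leq_max leqnn orbT.
  have m2m : m2 <= m by rewrite !leq_max leqnn !orbT.
  exists m => //.
  have xm : x (pi (m, c)) by apply: yx; exists m.
  suff [] : (b `&` x) (pi (m, c)) by [].
  rewrite bx_; split=> //; exists m, c; split=> //.
  apply/m2P => //; first by exists m.
  by apply: m1P m1m _ _.
(* [L] is a union of countably many [B m], so one of them has at least [lam] points, and [lam]
   embeds into it. *)
have [m nm Bm] : exists2 m, n <= m & [set: lam] #<= B m.
  apply: contrapT => nm; case: LS => /card_ltNge h _; apply: h.
  apply: card_le_trans (_ : _ #<= \bigcup_(m in [set m | n <= m]) B m) _.
    by apply: subset_card_le => c _; have [m nm2 Bc] := Bcov c; exists m.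
  apply: bigcup_card_le => //.
    exact: card_le_trans (card_leT _) (card_ltW (card_lt_le_trans natk (card_ltW klam))).
  move=> m nm'; have [//|Bm] := card_le_total (B m) [set: lam].
  by exfalso; apply: nm; exists m.
have [f [fB finj]] := card_leEinj b0 Bm.
(* The sets [D m d] for this [m], pulled back along [f], form the covering family. *)
exists (fun d => [set u | D m d (f u)]); split=> [d|y yc].
  apply: card_le_lt_trans (Dcard m d).
  by apply: (@card_le_inj _ _ _ _ f) => // u v _ _; apply: finj.
have [|x [Ax yx bx_]] := nP [set pi (m, f u) | u in y].
  apply: card_le_lt_trans natk; exact: card_le_trans (card_image_le _ _) yc.
exists (bx x) => u yu.
have : (b `&` x) (pi (m, f u)) by split; [apply: fB|apply: yx; exists u].
by rewrite bx_ => -[_ [m' [c [/piinj[-> <-]]]]].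
Qed.

(** * Covering by small sets *)

Definition covers T (dl : Card) (P : set (set T)) (U : set T) : Prop :=
  (forall p, P p -> p #<= [set: dl]) /\
  forall y, y `<=` U -> y #<= [set: dl] -> exists2 p, P p & y `<=` p.

Definition coverable T (dl : Card) (U : set T) V (N : set V) : Prop :=
  exists2 P : set (set T), P #<= N & covers dl P U.

Lemma coverable_le T (dl : Card) (U : set T) V (N : set V) V' (N' : set V') :
  N #<= N' -> coverable dl U N -> coverable dl U N'.
Proof. by move=> NN' [P PN Pc]; exists P => //; apply: card_le_trans PN NN'. Qed.

Lemma coverable_inj T T' (dl : Card) (U : set T) (U' : set T') V (N : set V) :
  U' #<= U -> coverable dl U N -> coverable dl U' N.
Proof.
move=> UU' [P PN [Pd Pc]].
have [[t0]|nT] := pselect (inhabited T); last first.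
  have U'0 : U' = set0.
    apply/seteqP; split=> x // Ux; apply: nT.
    have [g gP] := card_leEsurj x UU'.
    by have [t] := gP x Ux; split.
  exists [set set0 | p in P].
    exact: card_le_trans (card_image_le _ _) PN.
  split=> [_ [p _ <-]|y yU _]; first exact: card_ge0.
  have [//||p Pp _] := Pc set0; first exact: card_ge0.
  exists set0; first by exists p.
  by rewrite -U'0.
have [f [fU finj]] := card_leEinj t0 UU'.
pose h (p : set T) := [set x | U' x /\ p (f x)].
exists (h @` P); first exact: card_le_trans (card_image_le _ _) PN.
split=> [_ [p Pp <-]|y yU yd].
  apply: card_le_trans (Pd p Pp); apply: (@card_le_inj _ _ _ _ f) => [x []//|].
  by move=> x x' [Ux _] [Ux' _]; apply: finj.
have [||p Pp yp] := Pc (f @` y).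
- by move=> _ [x yx <-]; apply: fU; apply: yU.
- exact: card_le_trans (card_image_le _ _) yd.
exists (h p); first by exists p.
by move=> x yx; split; [apply: yU|apply: yp; exists x].
Qed.

Lemma covers_enum T (dl : Card) (P : set (set T)) (U : set T) (N : Card) :
  covers dl P U -> P #<= [set: N] -> exists h : N -> set T,
    (forall v, h v #<= [set: dl]) /\
    forall y, y `<=` U -> y #<= [set: dl] -> exists v, y `<=` h v.
Proof.
move=> [Pd Pc] PN; have [h hP] := card_leEsurj (set0 : set T) PN.
exists (fun v => if `[< P (h v) >] then h v else set0); split=> [v|y yU yd].
  by case: asboolP => [/Pd//|_]; apply: card_ge0.
have [p Pp yp] := Pc y yU yd; have [v _ hv] := hP p Pp; exists v.
by rewrite asboolT ?hv.
Qed.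

(* With U^+ many covering sets indexed by the ordinal U^+, of two sets y, y' the
   one of smaller index is found among the U many sets of index at most that of
   the other. *)
Lemma coverable_comparable T (dl c d : Card) (U : set T) :
  infinite_set U -> [set: c] #= U -> is_succ c d -> coverable dl U [set: d] ->
  exists Q : set T -> T -> set T, (forall y u, Q y u #<= [set: dl]) /\
    forall y y', y `<=` U -> y' `<=` U -> y #<= [set: dl] -> y' #<= [set: dl] ->
      exists2 u, U u & y `<=` Q y' u \/ y' `<=` Q y u.
Proof.
move=> Ui /card_eqPle[cU Uc] cd [P PN Pc].
have [h [hd hP]] := covers_enum Pc PN.
have di := succ_infinite (infinite_card_le Uc Ui) cd; have [v0 _] := infinite_setN0 di.
have /choice[nu nuP] : forall y, exists v, y `<=` U -> y #<= [set: dl] -> y `<=` h v.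
  move=> y; have [[yU yd]|n] := pselect (y `<=` U /\ y #<= [set: dl]).
    by have [v yv] := hP y yU yd; exists v.
  by exists v0 => yU yd; exfalso; apply: n.
(* [g r] lets [U] enumerate all indices up to [r]. *)
have /choice[g gP] : forall r : d, exists g : T -> d,
    forall v, ole v r -> exists2 u, U u & g u = v.
  move=> r; have [|g gP] := @card_leEsurj _ _ v0 [set v | ole v r] U; last by exists g.
  by apply: card_le_trans cU; apply: lt_succ_le cd _; apply: below_le_lt.
exists (fun y u => h (g (nu y) u)); split=> // y y' yU y'U yd y'd.
have [le|le] := ole_total (nu y) (nu y').
  by have [u Uu gu] := gP _ _ le; exists u => //; left; rewrite gu; apply: nuP.
by have [u Uu gu] := gP _ _ le; exists u => //; right; rewrite gu; apply: nuP.
Qed.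

Definition limit_pt (W : Ord) (i : W) : Prop :=
  (exists j, olt j i) /\ forall j, olt j i -> exists2 k, olt j k & olt k i.

(** Fodor's lemma for the set of all limits. If each value [j] were taken only below a bound [g j],
    a closure point [i] of [g] would lie below [g (h i)], which lies below [i]. *)
Lemma pressing_down (d : Card) (h : d -> d) : regular d ->
  [set: nat] #< [set: d] -> (forall i, limit_pt i -> olt (h i) i) ->
  exists j, forall x, exists i, [/\ limit_pt i, h i = j & olt x i].
Proof.
move=> dreg natd hlt; have [di _] := dreg; apply: contrapT => nj.
have /choice[g gP] : forall j, exists x, olt j x /\
    forall i, limit_pt i -> h i = j -> olt i x.
  move=> j; apply: contrapT => nx; apply: nj; exists j => x.
  apply: contrapT => ni; have [y xy] := card_no_max di (omax x j).
  apply: nx; exists y; split; first exact: ole_lt_trans (ole_omaxr _ _) xy.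
  move=> i li hi; apply: ole_lt_trans xy; apply: ole_trans (ole_omaxl _ _).
  by apply/oltNle => xi; apply: ni; exists i.
have [x0 _] := infinite_setN0 di.
have [i gi xi] := closure_pts_unbounded g dreg natd x0.
have li : limit_pt i.
  split; first by exists x0.
  by move=> j ji; exists (g j); [case: (gP j)|apply: gi].
have hi := hlt i li.
by apply: (@olt_irr d i); apply: olt_trans (gi _ hi); apply: (gP (h i)).2.
Qed.

(** * The induction step of the covering theorem, by the cofinality of [lam] *)

Section Covering.
Variables (dl lam L : Card).
Hypotheses (dli : infinite_set [set: dl]) (LS : is_succ lam L).
Hypothesis dl_lam : [set: dl] #< [set: lam].
Hypothesis IH : forall c d : Card, [set: c] #< [set: lam] -> is_succ c d ->
  coverable dl [set: c] [set: d].

Let lami : infinite_set [set: lam] := infinite_card_le (card_ltW dl_lam) dli.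

Let lam_L : [set: lam] #<= [set: L].
Proof. by case: LS => /card_ltW. Qed.

Lemma coverable_small T (U : set T) : U #< [set: lam] -> coverable dl U [set: lam].
Proof.
move=> Ulam; have [c /card_eqPle[cU Uc]] := card_of U.
have clam := card_le_lt_trans cU Ulam; have [d cd] := succ_exists c.
apply: coverable_inj Uc _; apply: coverable_le (IH clam cd).
by have [_ mind] := cd; apply: mind.
Qed.

Lemma cover_choice T : exists cv : set T -> set (set T),
  forall U, U #< [set: lam] -> cv U #<= [set: lam] /\ covers dl (cv U) U.
Proof.
suff /choice[cv cvP] : forall U : set T, exists P, U #< [set: lam] ->
    P #<= [set: lam] /\ covers dl P U by exists cv.
move=> U; have [Ulam|nU] := pselect (U #< [set: lam]); last by exists set0.
by have [P P1 P2] := coverable_small Ulam; exists P.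
Qed.

Lemma covering_large_cf (eps : Card) : is_cf lam eps -> [set: dl] #< [set: eps] ->
  coverable dl [set: lam] [set: L].
Proof.
move=> lam_eps dl_eps; have [cv cvP] := cover_choice lam.
have blam (x : lam) := card_initial x.
exists (\bigcup_(x in [set: lam]) cv (below x)).
  apply: card_le_trans lam_L; apply: bigcup_card_le => // x _.
  by have [] := cvP _ (blam x).
split=> [p [x _ cp]|y _ yd].
  by have [_ [h _]] := cvP _ (blam x); apply: h.
have [x xP] := lt_cf_bounded lam_eps (card_le_lt_trans yd dl_eps).
have [_ [_ h]] := cvP _ (blam x); have [p cp yp] := h y xP yd.
by exists p => //; exists x.
Qed.

(** A set [y] is coded by countably many indices [nu n] of sets covering its traces on the segments.
    The hypothesis puts the indices into some [P b], the induction hypothesis into a subfamily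
    member [R] of size at most [dl], and [H R] decodes. *)
Lemma covering_countable_cf : is_cf lam omega ->
  (exists P : L -> set lam, (forall b, P b #< [set: lam]) /\
    forall y : set lam, y #<= [set: nat] -> exists b, y `<=` P b) ->
  coverable dl [set: lam] [set: L].
Proof.
move=> lam_om [P [Plam Pc]]; have [x0 _] := infinite_setN0 lami.
have [chi [chim chicof]] := cf_cofinal_map x0 lam_om.
have [cv cvP] := cover_choice lam.
have /choice[g gP] : forall n : nat, exists g : lam -> set lam,
    (forall v, g v #<= [set: dl]) /\
    forall y, y `<=` below (chi n) -> y #<= [set: dl] -> exists v, y `<=` g v.
  move=> n; have [h1 h2] := cvP _ (card_initial (chi n)).
  by have [g gP] := covers_enum h2 h1; exists g.
pose H (R : set lam) := \bigcup_(n in [set: nat]) \bigcup_(u in R) g n u.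
have nat_dl : [set: nat] #<= [set: dl] by apply/infiniteP.
exists (\bigcup_(b in [set: L]) (H @` cv (P b))).
  apply: bigcup_card_le => //; first exact: infinite_card_le lam_L lami.
  move=> b _; apply: card_le_trans (card_image_le _ _) _.
  by have [h _] := cvP _ (Plam b); apply: card_le_trans h lam_L.
split=> [_ [b _ [R cR <-]]|y _ yd].
  have [_ [h _]] := cvP _ (Plam b).
  apply: bigcup_card_le => // n _; apply: bigcup_card_le => //; first exact: h.
  by move=> u _; have [] := gP n.
have /choice[nu nuP] : forall n : nat, exists v, y `&` below (chi n) `<=` g n v.
  move=> n; apply: (gP n).2 => [x []//|].
  exact: card_le_trans (subset_card_le (@subIsetl _ _ _)) yd.
have [|b nub] := Pc (range nu); first exact: card_image_le.
have [_ [_ h]] := cvP _ (Plam b).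
have [|R cR nuR] := h _ nub; first exact: card_le_trans (card_image_le _ _) nat_dl.
exists (H R); first by exists b => //; exists R.
move=> x yx; have [z xz] := card_no_max lami x; have [n zn] := chicof z.
exists n => //; exists (nu n); first by apply: nuR; exists n.
by apply: nuP; split=> //; apply: olt_le_trans xz zn.
Qed.

(** Silver's argument. At a limit [i] the traces on [U i] are comparable through some [u] in [U i],
    hence below [chi j] for a [j] before [i]. Pressing down fixes [j], and one of the two directions
    occurs for unboundedly many [i]. *)
Lemma comparability (eps : Card) : is_cf lam eps -> [set: eps] #<= [set: dl] ->
  [set: nat] #< [set: eps] ->
  exists Y : eps -> set lam -> set lam, (forall j y, Y j y #< [set: lam]) /\
    forall y y', y #<= [set: dl] -> y' #<= [set: dl] ->
      exists j, y `<=` Y j y' \/ y' `<=` Y j y.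
Proof.
move=> lam_eps eps_dl nat_eps; have [x0 _] := infinite_setN0 lami.
have eps_reg := cf_regular lami lam_eps; have [epsi _] := eps_reg.
have [chi0 [chi0m chi0cof]] := cf_cofinal_map x0 lam_eps.
have [p /card_eqPle[_ pdl]] := card_lt_below dl_lam.
pose chi i := omax (chi0 i) p.
have chicof (x : lam) : exists i, olt x (chi i).
  have [z xz] := card_no_max lami x; have [i zi] := chi0cof z; exists i.
  exact: olt_le_trans xz (ole_trans zi (ole_omaxl _ _)).
have Ndl i : [set: dl] #<= below (chi i).
  apply: card_le_trans pdl (subset_card_le _) => t tp.
  exact: olt_le_trans tp (ole_omaxr _ _).
have Ni i : infinite_set (below (chi i)) := infinite_card_le (Ndl i) dli.
pose U i := \bigcup_(j in below i) below (chi j).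
have chim i j : ole i j -> below (chi i) `<=` below (chi j).
  move=> /chi0m ij x /olt_le_trans; apply; rewrite /chi {1}/omax.
  by case: ifP => _; [exact: ole_omaxr|apply: ole_trans ij (ole_omaxl _ _)].
have Ulam i : U i #< [set: lam].
  apply: card_le_lt_trans (card_initial (chi i)); apply: subset_card_le.
  by move=> x [j ji xj]; apply: chim xj; apply: olt_ole.
have /choice[Q QP] : forall i : eps, exists Q : set lam -> lam -> set lam,
    (forall y u, Q y u #<= [set: dl]) /\ (limit_pt i ->
    forall y y', y `<=` U i -> y' `<=` U i -> y #<= [set: dl] -> y' #<= [set: dl] ->
      exists2 u, U i u & y `<=` Q y' u \/ y' `<=` Q y u).
  move=> i; have [[[j ji] _]|nli] := pselect (limit_pt i); last first.
    by exists (fun _ _ => set0); split=> // *; apply: card_ge0.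
  have Ui : infinite_set (U i).
    by apply: infinite_card_le (Ni j); apply: subset_card_le => x xj; exists j.
  have [c cU] := card_of (U i); have [d cd] := succ_exists c.
  have /card_eqPle[c1 c2] := cU.
  have clam := card_le_lt_trans c1 (Ulam i).
  have [Q [Q1 Q2]] := coverable_comparable Ui cU cd (coverable_inj c2 (IH clam cd)).
  by exists Q; split.
pose Y j y := \bigcup_(i in [set: eps]) \bigcup_(u in below (chi j)) Q i (y `&` U i) u.
exists Y; split=> [j y|y y' yd y'd].
  apply: card_le_lt_trans (card_initial (chi j)).
  apply: bigcup_card_le => //; first exact: card_le_trans eps_dl (Ndl j).
  move=> i _; apply: bigcup_card_le => // u _.
  exact: card_le_trans ((QP i).1 _ _) (Ndl j).
have subd (w : set lam) i : w #<= [set: dl] -> w `&` U i #<= [set: dl].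
  by apply: card_le_trans; apply: subset_card_le => x [].
pose sideA i j := exists2 u, below (chi j) u & y `&` U i `<=` Q i (y' `&` U i) u.
pose sideB i j := exists2 u, below (chi j) u & y' `&` U i `<=` Q i (y `&` U i) u.
have /choice[h hP] : forall i, exists j, limit_pt i ->
    olt j i /\ (sideA i j \/ sideB i j).
  move=> i; have [li|nli] := pselect (limit_pt i); last by exists i.
  have [||||u [j ji uj] side] := (QP i).2 li (y `&` U i) (y' `&` U i).
  - by move=> x [].
  - by move=> x [].
  - exact: subd.
  - exact: subd.
  by exists j => _; split=> //; case: side => side; [left|right]; exists u.
have [|j jP] := pressing_down eps_reg nat_eps (h := h).
  by move=> i /hP[].
exists j; have [Aub|nA] := pselect (forall x, exists i, sideA i j /\ olt x i).
  left=> t yt; have [k tk] := chicof t; have [i [[u uj yu] ki]] := Aub k.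
  exists i => //; exists u => //; apply: yu; split=> //; by exists k.
right; have [x nx] : exists x, forall i, olt x i -> ~ sideA i j.
  apply: contrapT => nx; apply: nA => x; apply: contrapT => ni; apply: nx.
  by exists x => i xi si; apply: ni; exists i.
move=> t yt; have [k tk] := chicof t; have [i [li hi ki]] := jP (omax x k).
have [_ []] := hP i li; rewrite hi.
  by move=> /(nx i (ole_lt_trans (ole_omaxl _ _) ki)).
move=> [u uj yu]; exists i => //; exists u => //; apply: yu; split=> //; exists k => //.
exact: ole_lt_trans (ole_omaxr _ _) ki.
Qed.

(** Without a cover, [y k] can be kept out of each union of earlier [y l] over [D i k], and [ys] out
    of all sets in the families [CC (y k)]. By comparability every [y k] lies in a member of
    [CC ys], and one member [p] catches cofinally many; an increasing subsequence then gives [p] too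
    many points. *)
Lemma covering_uncountable_cf (eps : Card) : is_cf lam eps ->
  [set: eps] #<= [set: dl] -> [set: nat] #< [set: eps] ->
  coverable dl [set: lam] [set: L].
Proof.
move=> lam_eps eps_dl nat_eps; apply: contrapT => ncov.
have eps_lam := card_le_lt_trans eps_dl dl_lam.
have lam_sing : singular lam by split=> //; exists eps.
have L_reg := succ_regular lami LS; have [Li _] := L_reg.
have ncov' (P : set (set lam)) : P #<= [set: L] -> (forall p, P p -> p #<= [set: dl]) ->
    exists2 y, y #<= [set: dl] & forall p, P p -> ~ y `<=` p.
  move=> PL Pd; apply: contrapT => ny; apply: ncov; exists P => //; split=> // y _ yd.
  apply: contrapT => np; apply: ny; exists y => // p Pp yp; apply: np; by exists p.
have [Y [Ylam Ycomp]] := comparability lam_eps eps_dl nat_eps.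
have [cv cvP] := cover_choice lam.
pose CC y := \bigcup_(j in [set: eps]) cv (Y j y).
have CClam y : CC y #<= [set: lam].
  apply: bigcup_card_le => //; first exact: card_ltW.
  by move=> j _; have [] := cvP _ (Ylam j y).
have CCd y p : CC y p -> p #<= [set: dl].
  by move=> [j _ cp]; have [_ [h _]] := cvP _ (Ylam j y); apply: h.
have CCc j y y' : y' #<= [set: dl] -> y' `<=` Y j y -> exists2 p, CC y p & y' `<=` p.
  move=> y'd y'Y; have [_ [_ h]] := cvP _ (Ylam j y).
  by have [p cp yp] := h y' y'Y y'd; exists p => //; exists j.
have [t0 t0S] := succ_exists dl; have [t1 t1S] := succ_exists t0.
have [eta etaS] := succ_exists t1.
have t0_lam := singular_succ_lt lam_sing dl_lam (card_eqxx _) t0S.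
have t1_lam := singular_succ_lt lam_sing t0_lam (card_eqxx _) t1S.
have eta_lam := singular_succ_lt lam_sing t1_lam (card_eqxx _) etaS.
have dl_t0 : [set: dl] #< [set: t0] by case: t0S.
have t0_reg := succ_regular dli t0S.
have [D [Dcard Dself Dmon DK]] := approachability_matrix lam_sing LS lam_eps
  t0_reg t1S etaS (card_le_lt_trans eps_dl dl_t0) eta_lam.
pose V (f : L -> set lam) i k := \bigcup_(l in D i k `&` below k) f l.
have [||y yP] := @wo_rec L (set lam) set0 (fun k f t => [/\ t #<= [set: dl],
    forall l, olt l k -> forall p, CC (f l) p -> ~ t `<=` p &
    forall i, ~ t `<=` V f i k]).
- move=> k f g t fg [h1 h2 h3]; split=> // [l lk|i]; first by rewrite -fg//; apply: h2.
  suff <- : V f i k = V g i k by [].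
  by apply: eq_bigcupr => l [_ lk]; apply: fg.
- move=> k f fP.
  have Vlam i : V f i k #< [set: lam].
    have [z /card_eqPle[_ zlam]] := card_lt_below (Dcard i k).
    have [q /card_eqPle[_ qdl]] := card_lt_below dl_lam.
    have sub (a b : lam) : ole a b -> below a #<= below b.
      by move=> ab; apply: subset_card_le => x xa; apply: olt_le_trans xa ab.
    have dlN : [set: dl] #<= below (omax z q).
      exact: card_le_trans qdl (sub _ _ (ole_omaxr _ _)).
    apply: card_le_lt_trans (card_initial (omax z q)).
    apply: bigcup_card_le; first exact: infinite_card_le dlN dli.
      apply: card_le_trans (subset_card_le (@subIsetl _ _ _)) _.
      exact: card_le_trans zlam (sub _ _ (ole_omaxl _ _)).
    by move=> l [_ lk]; have [fl _ _] := fP l lk; apply: card_le_trans fl dlN.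
  have [||t td tP] := ncov' ((\bigcup_(l in below k) CC (f l)) `|`
      \bigcup_(i in [set: eps]) cv (V f i k)).
  + apply: card_le_trans lam_L; apply: infinite_setU_le => //.
      by apply: bigcup_card_le => //; apply: below_succ_le LS.
    apply: bigcup_card_le => //; first exact: card_ltW.
    by move=> i _; have [] := cvP _ (Vlam i).
  + move=> p [[l _ /CCd//]|[i _ cp]].
    by have [_ [h _]] := cvP _ (Vlam i); apply: h.
  exists t; split=> // [l lk p cp|i tV].
    by apply: tP; left; exists l.
  have [_ [_ h]] := cvP _ (Vlam i); have [p cp tp] := h t tV td.
  by apply: (tP p) => //; right; exists i.
have [||ys ysd ysP] := ncov' (\bigcup_(k in [set: L]) CC (y k)).
- apply: bigcup_card_le => // k _; exact: card_le_trans (CClam _) lam_L.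
- by move=> p [k _ /CCd].
have ycov k : exists2 p, CC ys p & y k `<=` p.
  have [yd _ _] := yP k; have [j [ysY|yY]] := Ycomp _ _ ysd yd; last exact: CCc yY.
  have [p cp ysp] := CCc _ _ _ ysd ysY.
  by exfalso; apply: (ysP p) => //; exists k.
have [p cp pcof] : exists2 p, CC ys p & cofinal [set k | y k `<=` p].
  apply: contrapT => np.
  have /choice[x xP] : forall p, exists x, CC ys p -> forall k, y k `<=` p -> olt k x.
    move=> p; have [b0 _] := infinite_setN0 Li.
    have [cp|ncp] := pselect (CC ys p); last by exists b0.
    apply: contrapT => nx; apply: np; exists p => // x; apply: contrapT => nk.
    apply: nx; exists x => _ k yk; apply/oleNlt => xk; apply: nk; by exists k.
  have [|b bP] := @regular_bounded L (x @` CC ys) L_reg.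
    apply: card_le_lt_trans (card_image_le _ _) _.
    by apply: card_le_lt_trans (CClam ys) _; case: LS.
  have [p cp yp] := ycov b.
  apply: (@olt_irr L b); apply: olt_trans (xP p cp b yp) _.
  by apply: bP; exists p.
have [X [i0 [XK t0X _ Xmon]]] := DK _ pcof.
suff Xp : X #<= p.
  apply: (@card_lt_irr _ [set: t0]); apply: card_le_lt_trans dl_t0.
  exact: card_le_trans t0X (card_le_trans Xp (CCd _ _ cp)).
(* [k] is sent to a point of [y k] outside all earlier [y l] with [l] in [X]; it exists because such
   an [l] lies in [D i0 l], hence in [D i0 k]. *)
apply: (@card_le_rel _ _ _ _ (fun k v => y k v /\ forall l, X l -> olt l k -> ~ y l v)).
  move=> k Xk; have [_ _ /(_ i0) nV] := yP k.
  apply: contrapT => nv; apply: nV => v yv; apply: contrapT => nVv.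
  apply: nv; exists v; first exact: (XK k Xk).
  split=> // l Xl lk yl; apply: nVv; exists l => //; split=> //.
  by apply: (Xmon i0 l k) => //; apply: ole_refl.
move=> k k' v Xk Xk' [yk hk] [yk' hk']; apply: ole_anti; apply/oltNle => lt.
  exact: (hk k').
exact: (hk' k).
Qed.

End Covering.

(** A least counterexample [lam] is excluded by cases. At most [dl], it is covered by one set;
    otherwise its cofinality is above [dl], uncountable up to [dl], or countable, where branches of
    narrow systems are used. *)
Theorem cNSP_covering (kappa omega1 omega2 dl : Card) :
  is_succ omega omega1 -> is_succ omega1 omega2 ->
  [set: omega2] #<= [set: kappa] -> regular kappa -> cNSP kappa ->
  [set: kappa] #<= [set: dl] ->
  forall lam L : Card, is_succ lam L -> coverable dl [set: lam] [set: L].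
Proof.
move=> o1 o2 o2k kreg nsp kdl lam0 L0 LS0; apply: contrapT => ncov0.
have [ki _] := kreg; have dli := infinite_card_le kdl ki.
have [|lam [[L [LS ncov]] min]] := @least_card
    (fun lam => exists L, is_succ lam L /\ ~ coverable dl [set: lam] [set: L]).
  by exists lam0, L0.
have IH (c d : Card) : [set: c] #< [set: lam] -> is_succ c d ->
    coverable dl [set: c] [set: d].
  move=> clam cd; apply: contrapT => nc; apply: (@card_lt_irr _ [set: c]).
  by apply: card_lt_le_trans clam _; apply: min; exists d.
apply: ncov; have [dl_lam|lam_dl] := card_lt_leP [set: dl] [set: lam]; last first.
  exists [set setT]; last by split=> [_ ->//|y _ _]; exists setT.
  have : [set: lam] #< [set: L] by case: LS.
  move=> /card_ltNge nle; have [b _] : [set: L] !=set0.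
    apply: contrapT => n0; apply: nle; have -> : [set: L] = set0; last exact: card_ge0.
    by apply/seteqP; split=> x // _; apply: n0; exists x.
  by apply: (@card_le_inj _ _ _ _ (fun=> b)) => // x y -> ->.
have lami := infinite_card_le (card_ltW dl_lam) dli.
have [eps lam_eps] := cf_exists lam.
have [dl_eps|eps_dl] := card_lt_leP [set: dl] [set: eps].
  exact: (@covering_large_cf dl lam L dli LS dl_lam IH eps).
have lam_sing : singular lam.
  by split=> //; exists eps => //; apply: card_le_lt_trans eps_dl dl_lam.
have [nat_eps|eps_nat] := card_lt_leP [set: nat] [set: eps].
  exact: (@covering_uncountable_cf dl lam L dli LS dl_lam IH eps).
have lam_om : is_cf lam omega.
  apply: (is_cf_eq lam_eps); apply: Cantor_Bernstein => //.
  by apply/infiniteP; apply: cf_infinite lam_eps.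
apply: (@covering_countable_cf dl lam L dli LS dl_lam IH) => //.
apply: (cNSP_countable_cover o1 o2 o2k) => //.
exact: card_le_lt_trans kdl dl_lam.
Qed.

(** * Pseudopowers *)

Lemma seg_bounded (W : Ord) (al : W) (S : set W) : regular (seg al) ->
  S `<=` below al -> S #< below al ->
  exists2 g, olt g al & forall v, S v -> olt v g.
Proof.
move=> [_ [_ _ cf]] Sal /card_ltNge nle; apply: contrapT => ng; apply: nle.
apply: card_le_trans (card_le_sub_setT _) _.
apply: card_le_trans (_ : _ #<= [set u : seg al | S (val u)]) _; last first.
  by apply: (@card_le_inj _ _ _ _ val) => // u v _ _ /val_inj.
apply: cf => x; apply: contrapT => ny; apply: ng.
exists (val x); first exact: (set_mem (valP x)).
move=> v Sv; apply/oleNlt => xv; apply: ny.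
by exists (SigSub (mem_set (Sal v Sv))).
Qed.

Lemma seg_succ (W : Ord) (al : W) : regular (seg al) ->
  forall x, olt x al -> exists2 y, olt x y & olt y al.
Proof.
move=> sreg x xal; have [si _] := sreg; have [||g gal xg] := @seg_bounded W al [set x] sreg.
- by move=> _ ->.
- apply: finite_lt_infinite => // fal; apply: si.
  exact: card_le_finite (card_le_setT_sub _) fal.
by exists g => //; apply: xg.
Qed.

Lemma below_lt (W : Ord) (x y : W) : below x #< below y -> olt x y.
Proof.
move=> /card_ltNge lt; apply/oleNlt => yx; apply: lt; apply: subset_card_le => z zy.
exact: olt_le_trans zy yx.
Qed.

Lemma singular_below (mu : Card) T (A : set T) : singular mu -> A #< [set: mu] ->
  exists z : mu, A #< below z.
Proof.
move=> ms Amu; have [c cA] := card_of A; have [d cd] := succ_exists c.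
have dmu := singular_succ_lt ms Amu cA cd.
have [z /card_eqPle[_ dz]] := card_lt_below dmu; exists z.
have /card_eqPle[_ Ac] := cA; have [clt _] := cd.
exact: card_le_lt_trans Ac (card_lt_le_trans clt dz).
Qed.

(** For the least [al] whose segment outgrows that of [x], [seg al] is a successor cardinal, hence
    regular; it exists since a singular cardinal is a limit cardinal. *)
Lemma next_regular (mu : Card) (x : mu) : singular mu -> infinite_set (below x) ->
  exists al : mu, [/\ olt x al, regular (seg al), below x #< below al &
    forall z : mu, below x #< below z -> below al #<= below z].
Proof.
move=> ms xi.
have [|al [xal almin]] := @wo_least mu (fun z => below x #< below z).
  exact: singular_below (card_initial x).
have alP (z : mu) : below x #< below z -> below al #<= below z.
  by move=> /almin alz; apply: subset_card_le => t tal; apply: olt_le_trans tal alz.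
exists al; split=> //; first exact: below_lt.
have segi : initial (seg al).
  move=> y; have yal : olt (val y) al := set_mem (valP y).
  apply: card_le_lt_trans (_ : _ #<= below (val y)) _.
    by apply: (@card_le_inj _ _ _ _ val) => // u v _ _ /val_inj.
  apply: card_lt_le_trans (card_le_sub_setT _).
  apply: card_le_lt_trans (_ : _ #<= below x) xal.
  by apply/card_leNgt => /almin /oltNle.
have [c /card_eqPle[cx xc]] := card_of (below x).
have cd : is_succ c (MkCard segi).
  split=> [|e ce].
    apply: card_le_lt_trans cx _; apply: card_lt_le_trans xal _.
    exact: card_le_sub_setT.
  apply: card_le_trans (card_le_setT_sub _) _.
  apply/card_leNgt => eal; have xe := card_le_lt_trans xc ce.
  have [z /card_eqPle[ze ez]] := card_lt_below (card_lt_le_trans eal (card_leT _)).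
  apply: (@card_lt_irr _ [set: e]); apply: card_lt_le_trans eal _.
  apply: card_le_trans (alP z _) ze; exact: card_lt_le_trans xe ez.
exact: succ_regular (infinite_card_le xc xi) cd.
Qed.

Section LtMod.
Variables (m : Ord) (a : set m) (I : set (set m)).
Hypothesis Iid : ideal_on a I.

Lemma lt_mod_trans f g h : lt_mod a I f g -> lt_mod a I g h -> lt_mod a I f h.
Proof.
move=> fg gh; have [_ _ _ Isub IU] := Iid; apply: Isub (IU _ _ fg gh) _.
move=> al [aal nfh]; have [lt|nlt] := pselect (olt (f al) (g al)); last by left.
by right; split=> // lt'; apply: nfh; apply: olt_trans lt lt'.
Qed.

Lemma lt_mod_irr f : ~ lt_mod a I f f.
Proof.
move=> ff; have [_ nIa _ Isub _] := Iid; apply: nIa; apply: Isub ff _ => al aal.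
by split=> //; apply: olt_irr.
Qed.

End LtMod.

(** If [theta] exceeded [nu], one covering set [q] of size at most [dl] would contain the values on
    [a] of cofinally many [F i]. Some [g] in the product bounds [q] almost everywhere, and an [F i0]
    above [g] contradicts a later [F i] with values in [q]. *)
Lemma pp_set_le (kappa omega1 omega2 mu nu theta : Card) :
  is_succ omega omega1 -> is_succ omega1 omega2 ->
  [set: omega2] #<= [set: kappa] -> regular kappa -> cNSP kappa ->
  singular mu -> [set: kappa] #< [set: mu] -> is_succ mu nu ->
  pp_set mu theta -> [set: theta] #<= [set: nu].
Proof.
move=> o1 o2 o2k kreg nsp ms kmu nuS [a [I [[acof areg] [c muc ac] Iid JI]]].
move=> [theta_reg [F [FX Finc Fcof]]]; apply/card_leNgt => nu_theta.
have cmu : [set: c] #< [set: mu].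
  have [_ [c' [_ [b' b'cof b'c] _] c'mu]] := ms; have [_ _ cmin] := muc.
  apply: card_le_lt_trans c'mu; have /card_eqPle[h _] := b'c.
  exact: card_le_trans (cmin b' b'cof) h.
have [dl [kdl cdl dlmu]] : exists dl : Card,
    [/\ [set: kappa] #<= [set: dl], [set: c] #<= [set: dl] & [set: dl] #< [set: mu]].
  by have [kc|ck] := card_le_total [set: kappa] [set: c]; [exists c|exists kappa].
have [P Pnu [Pd Pc]] := cNSP_covering o1 o2 o2k kreg nsp kdl nuS.
have /choice[p pP] : forall i, exists p, P p /\ F i @` a `<=` p.
  move=> i; have [//||p Pp yp] := Pc (F i @` a); last by exists p.
  exact: card_le_trans (card_image_le _ _) (card_le_trans ac cdl).
have [q Pq qcof] : exists2 q, P q & cofinal [set i | p i = q].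
  apply: contrapT => nq.
  have [t0 _] := infinite_setN0 theta_reg.1.
  have /choice[x xP] : forall q, exists x : theta, P q -> forall i, p i = q -> olt i x.
    move=> q; have [Pq|nPq] := pselect (P q); last by exists t0.
    apply: contrapT => nx; apply: nq; exists q => // x; apply: contrapT => ni.
    by apply: nx; exists x => _ i pi; apply/oleNlt => xi; apply: ni; exists i.
  have [|b bP] := @regular_bounded theta (x @` P) theta_reg.
    apply: card_le_lt_trans (card_image_le _ _) _.
    exact: card_le_lt_trans Pnu nu_theta.
  have [Ppb _] := pP b; apply: (@olt_irr theta b).
  by apply: olt_trans (xP _ Ppb b erefl) _; apply: bP; exists (p b).
have [z dlz] := singular_below ms dlmu.
(* From [z] on, [al] has more than [dl] points below it, so [q] is bounded in it; the [al] below [z]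
   form a set in [I]. *)
have /choice[g gP] : forall al, exists v, a al -> olt v al /\
    (ole z al -> forall w, q w -> olt w al -> olt w v).
  move=> al; have [aal|naal] := pselect (a al); last by exists al.
  have sreg := areg al aal.
  have [zal|nzal] := pselect (ole z al); last first.
    have [si _] := sreg; have [x _] := infinite_setN0 si.
    by exists (val x) => _; split=> //; apply: (set_mem (valP x)).
  have [||v val vP] := @seg_bounded mu al (q `&` below al) sreg.
  - by move=> ? [].
  - apply: card_le_lt_trans (subset_card_le (@subIsetl _ _ _)) _.
    apply: card_le_lt_trans (Pd q Pq) _; apply: card_lt_le_trans dlz _.
    by apply: subset_card_le => t tz; apply: olt_le_trans tz zal.
  by exists v => _; split=> // _ w qw wal; apply: vP.
have [|i0 gi0] := Fcof g; first by move=> al /gP[].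
have [i' i0i'] := card_no_max theta_reg.1 i0.
have [i pi i'i] := qcof i'; have i0i := Finc _ _ (olt_le_trans i0i' i'i).
have [_ nIa _ Isub IU] := Iid; apply: nIa.
have bad : I [set al | a al /\ olt al z] by apply: JI; split=> [al []//|]; exists z => al [].
(* The three exceptional sets cover [a], since elsewhere [F i al] would be both above and below
   [g al]. *)
apply: Isub (IU _ _ bad (IU _ _ gi0 i0i)) _ => al aal.
have [alz|zal] := olt_leP al z; first by left.
right; have [lt1|nlt1] := pselect (olt (g al) (F i0 al)); last by left.
right; split=> // lt2; apply: (@olt_irr mu (g al)).
apply: olt_trans (olt_trans lt1 lt2) _; apply: (gP al aal).2 => //.
  by rewrite -pi; apply: (pP i).2; exists al.
exact: FX.
Qed.

(* Linearity of [lt] enters only through the existence of successors. *)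
Lemma linear_cofinality T (X : set T) (lt : T -> T -> Prop) V (N : set V) :
  infinite_set N ->
  (forall f g h, lt f g -> lt g h -> lt f h) -> (forall f, ~ lt f f) ->
  (forall f, X f -> exists f', [/\ X f', lt f f' &
     forall t, X t -> ~ lt f t -> lt t f']) ->
  (forall K, K `<=` X -> K #<= N -> exists2 g, X g & forall f, K f -> lt f g) ->
  exists theta : Card, [/\ regular theta, N #< [set: theta] &
    exists F : theta -> T, [/\ forall i, X (F i),
      forall i j, olt i j -> lt (F i) (F j) &
      forall g, X g -> exists i, lt g (F i)]].
Proof.
move=> Ni lttr ltirr Xsucc Xdir.
have [x0 Xx0 _] : exists2 g, X g & forall f, set0 f -> lt f g.
  by apply: Xdir => //; apply: card_ge0.
have /choice[s sP] : forall f, exists f', X f -> [/\ X f', lt f f' &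
     forall t, X t -> ~ lt f t -> lt t f'].
  move=> f; have [Xf|nXf] := pselect (X f); last by exists f.
  by have [f' f'P] := Xsucc f Xf; exists f'.
pose P (theta : Card) := exists H : theta -> T, (forall i, X (H i)) /\
  forall g, X g -> exists i, lt g (H i).
(* A set cofinal only in the weak sense that no [t] surpasses all its members becomes cofinal after
   applying [s]. *)
have PK (K : set T) : K `<=` X ->
    (forall t, X t -> exists2 f, K f & ~ lt f t \/ lt t f) ->
    exists2 e, P e & [set: e] #<= K.
  move=> KX Kcof; have [e /card_eqPle[eK Ke]] := card_of K; exists e => //.
  have [h hP] := card_leEsurj x0 Ke.
  exists (fun i => s (if `[< K (h i) >] then h i else x0)); split=> [i|g Xg].
    by case: asboolP => [/KX/sP[]//|_]; case: (sP x0 Xx0).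
  have [f Kf ft] := Kcof g Xg; have [i _ hi] := hP f Kf; exists i.
  rewrite asboolT ?hi//; have [_ ff' fmax] := sP f (KX f Kf).
  by case: ft => [nft|gf]; [apply: fmax|apply: lttr gf ff'].
have [|theta [[H [HX Hcof]] min]] := @least_card P.
  have [//|t Xt|e Pe _] := PK X; last by exists e.
  by exists t => //; left; apply: ltirr.
have Ntheta : N #< [set: theta].
  apply/card_ltNge => le; have [||g Xg gP] := Xdir (range H).
  - by move=> _ [i _ <-].
  - exact: card_le_trans (card_image_le _ _) le.
  have [i gi] := Hcof g Xg; apply: (ltirr g); apply: lttr gi _.
  by apply: gP; exists i.
have thetai : infinite_set [set: theta] := infinite_card_le (card_ltW Ntheta) Ni.
have [||F FP] := @wo_rec theta T x0 (fun i f t =>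
    [/\ X t, lt (H i) t & forall j, olt j i -> lt (f j) t]).
- by move=> i f g t fg [h1 h2 h3]; split=> // j ji; rewrite -fg//; apply: h3.
- move=> i f fP; apply: contrapT => nt.
  (* If no value fits, the earlier values together with [H i] are weakly cofinal, although fewer
     than [theta]. *)
  pose k j := if `[< olt j i >] then f j else H i.
  have [||e Pe eK] := PK (k @` [set j | ole j i]).
  + by move=> _ [j _ <-]; rewrite /k; case: asboolP => [/fP[]|_].
  + move=> t Xt; apply: contrapT => nf; apply: nt; exists t; split=> //.
      apply: contrapT => nlt; apply: nf; exists (H i); last by left.
      by exists i; [apply: ole_refl|rewrite /k asboolF//; apply: olt_irr].
    move=> j ji; apply: contrapT => nlt; apply: nf; exists (f j); last by left.
    by exists j; [apply: olt_ole|rewrite /k asboolT].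
  apply: (@card_lt_irr _ [set: theta]).
  apply: card_le_lt_trans (card_le_trans (min e Pe) eK) _.
  apply: card_le_lt_trans (card_image_le _ _) _.
  exact: below_le_lt.
have Finc i j : olt i j -> lt (F i) (F j) by move=> ij; have [_ _] := FP j; apply.
have Fcof g : X g -> exists i, lt g (F i).
  move=> /Hcof[i gi]; exists i; apply: lttr gi _; by have [] := FP i.
exists theta; split=> //; last by exists F; split=> // i; have [] := FP i.
split=> //; split; first exact: card_initial.
  by exists [set: theta] => // x; exists x => //; apply: ole_refl.
move=> B Bcof; have [||e Pe eK] := PK (F @` B).
- by move=> _ [i _ <-]; have [] := FP i.
- move=> t /Fcof[i ti]; have [j Bj ij] := Bcof i; exists (F j); first by exists j.
  right; have [<-//|nij] := pselect (i = j).
  by apply: lttr ti _; apply: Finc; apply: olt_neq.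
exact: card_le_trans (min e Pe) (card_le_trans eK (card_image_le _ _)).
Qed.

(** The product of the successor cardinals [A i], modulo the dual ideal of an ultrafilter containing
    all tails, is linear up to equivalence, and families of size [mu] are bounded in it; hence it
    has a true cofinality above [mu]. *)
Lemma pp_set_gt (mu : Card) : singular mu ->
  exists2 theta, pp_set mu theta & [set: mu] #< [set: theta].
Proof.
move=> ms; have [mui [c muc cmu]] := ms; have [x0 _] := infinite_setN0 mui.
have ci := cf_infinite mui muc.
have [p /card_eqPle[_ pnat]] := card_lt_below cmu.
have [chi0 [_ chi0cof]] := cf_cofinal_map x0 muc.
pose chi i := omax (chi0 i) p.
have chi_inf i : infinite_set (below (chi i)).
  apply: infinite_card_le (infinite_card_le pnat ci).
  by apply: subset_card_le => t tp; apply: olt_le_trans tp (ole_omaxr _ _).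
have /choice[A AP] : forall i, exists al : mu, [/\ olt (chi i) al, regular (seg al),
    below (chi i) #< below al &
    forall z : mu, below (chi i) #< below z -> below al #<= below z].
  by move=> i; apply: next_regular.
pose a := range A.
have acof : cofinal a.
  move=> x; have [i xi] := chi0cof x; exists (A i); first by exists i.
  have [lt _ _ _] := AP i; apply: ole_trans xi (ole_trans (ole_omaxl _ _) (olt_ole lt)).
have areg al : a al -> regular (seg al) by move=> [i _ <-]; have [] := AP i.
pose F0 : set_system mu := [set B | exists b, forall al, a al -> ole b al -> B al].
have F0p : ProperFilter F0.
  split.
    by move=> [b bP]; have [al aal bal] := acof b; apply: (bP al).
  split=> [|B B' [b bP] [b' b'P]|B B' BB' [b bP]].
  - by exists x0.
  - exists (omax b b') => al aal le; split.
      by apply: bP => //; apply: ole_trans (ole_omaxl _ _) le.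
    by apply: b'P => //; apply: ole_trans (ole_omaxr _ _) le.
  - by exists b => al aal le; apply: BB'; apply: bP.
have [G [GU F0G]] := ultraFilterLemma F0p.
have Ga : G a by apply: F0G; exists x0.
pose I := [set b | b `<=` a /\ G (~` b)].
have Iid : ideal_on a I.
  split.
  - by split=> //; rewrite setC0; apply: filterT.
  - move=> [_ Gna]; apply: (@filter_not_empty _ G _).
    by rewrite -(setICr a); apply: filterI.
  - by move=> b [].
  - move=> b d [da Gd] bd; split=> [x /bd/da//|].
    by apply: filterS Gd; apply: subsetC.
  - move=> b d [ba Gb] [da Gd]; split=> [x [/ba|/da]//|].
    by rewrite setCU; apply: filterI.
have JI : Jbd a `<=` I.
  move=> b [ba [be bP]]; split=> //; apply: F0G; exists be => al _ beal bal.
  exact: (olt_irr (olt_le_trans (bP al bal) beal)).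
have Isub b d : I d -> b `<=` d -> I b by have [_ _ _ + _] := Iid; apply.
have [||||theta [theta_reg mu_theta [F [F1 F2 F3]]]] :=
  @linear_cofinality _ (ord_prod a) (lt_mod a I) _ [set: mu] mui.
- exact: lt_mod_trans.
- exact: lt_mod_irr.
- move=> f fX.
  have /choice[f' f'P] : forall al, exists y, a al -> olt (f al) y /\ olt y al.
    move=> al; have [aal|naal] := pselect (a al); last by exists al.
    by have [y fy yal] := seg_succ (areg al aal) (fX al aal); exists y.
  have I0 : I set0 by case: Iid.
  exists f'; split=> [al /f'P[]//||t tX nft].
    by apply: Isub I0 _ => al [/f'P[]].
  (* The ultrafilter decides: either [t] is at most [f], hence below [f'], almost everywhere, or [f]
     is below [t] modulo [I]. *)
  have [Gb|Gb] := in_ultra_setVsetC [set al | a al /\ ~ olt (f al) (t al)] GU; last first.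
    by exfalso; apply: nft; split=> // al [].
  split=> [al []//|]; apply: filterS Gb => al [aal /oltNle tf] [_]; apply.
  by have [ff' _] := f'P al aal; apply: ole_lt_trans tf ff'.
- move=> K KX Kmu; have [r [_ rinj]] := card_leEinj x0 Kmu.
  have [i0 _] := chi0cof x0.
  have /choice[ix ixP] : forall al, exists i, a al -> A i = al.
    move=> al; have [[i _ iA]|naal] := pselect (a al); last by exists i0.
    by exists i.
  (* [g al] bounds only the [f] whose code is below [chi (ix al)], which are too few to be unbounded
     in [al]; each [f] is caught for all but boundedly many [al]. *)
  have /choice[g gP] : forall al, exists v, a al -> olt v al /\
      forall f, K f -> olt (r f) (chi (ix al)) -> olt (f al) v.
    move=> al; have [aal|naal] := pselect (a al); last by exists al.
    pose S := [set f al | f in [set f | K f /\ olt (r f) (chi (ix al))]].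
    have [_ _ lt _] := AP (ix al); rewrite ixP// in lt.
    have [||v val vP] := @seg_bounded mu al S (areg al aal).
    + by move=> _ [f [Kf _] <-]; apply: KX.
    + apply: card_le_lt_trans (card_image_le _ _) _.
      apply: card_le_lt_trans lt; apply: (@card_le_inj _ _ _ _ r) => [f []//|].
      by move=> f f' [Kf _] [Kf' _]; apply: rinj.
    by exists v => _; split=> // f Kf rf; apply: vP; exists f.
  exists g; first by move=> al /gP[].
  move=> f Kf; apply: JI; split=> [al []//|].
  have [z rz] := singular_below ms (card_initial (r f)).
  have [z' zz'] := singular_below ms (card_initial z).
  exists z' => al [aal nlt]; have [_ glt] := gP al aal.
  (* Where [f] is not caught, [chi (ix al)] is at most [r f], so [al] has at most as many
     predecessors as [z]. *)
  have /oltNle le : ~ olt (r f) (chi (ix al)) by move=> /(glt f Kf).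
  have [_ _ _ Amin] := AP (ix al); rewrite ixP// in Amin.
  apply: below_lt; apply: card_le_lt_trans (Amin z _) zz'.
  apply: card_le_lt_trans rz; apply: subset_card_le => t tc.
  exact: olt_le_trans tc le.
exists theta => //; exists a, I; split=> //.
- by exists c => //; apply: card_image_le.
- by split=> //; exists F.
Qed.

Theorem theoremA (kappa : Card) (omega1 omega2 : Card)
  (omega1_def : is_succ omega omega1) (omega2_def : is_succ omega1 omega2)
  (kappa_ge : [set: omega2] #<= [set: kappa]) (kappa_reg : regular kappa)
  (kappa_cNSP : cNSP kappa) :
  forall mu : Card, singular mu -> [set: kappa] #< [set: mu] ->
    exists2 nu : Card, is_succ mu nu & is_pp mu nu.
Proof.
move=> mu mu_sing kappa_mu; have [nu nuS] := succ_exists mu; exists nu => //.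
split=> [theta|t tub].
  exact: (pp_set_le omega1_def omega2_def kappa_ge).
have [theta thetapp mu_theta] := pp_set_gt mu_sing.
by apply: card_le_trans (tub theta thetapp); have [_ nu_min] := nuS; apply: nu_min.
Qed.
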